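(* Let $\mathcal{C}$ be a geometrically griddable permutation class. Let $\mathcal{S}$ be any one of the following three sets: the set of simple permutations in $\mathcal{C}$, the set of sum indecomposable permutations in $\mathcal{C}$, or the set of skew indecomposable permutations in $\mathcal{C}$. Then there is a regular language $L$ over a finite alphabet and a length-preserving bijection $L\to\mathcal{S}$; and thus the generating function $\sum_{\pi\in\mathcal{S}}x^{|\pi|}$ is rational.
   Context: A permutation of length $n\ge 0$ is a bijection of $\{1,\dots,n\}$, written in one-line notation; $|\pi|$ denotes the length of $\pi$. A permutation $\pi$ of length $n$ contains a permutation $\sigma$ of length $k$ (written $\sigma\le\pi$) if $\pi$ has a subsequence of length $k$ that is order isomorphic to $\sigma$. A permutation class is a set of permutations that is downward closed under $\le$. An interval in a permutation $\pi$ is a set of contiguous indices $I=[a,b]$ such that the set of values $\{\pi(i):i\in I\}$ is also contiguous. Every permutation of length $n$ has trivial intervals of lengths $0$, $1$ and $n$; a permutation of length at least $2$ is simple if it has no other intervals. For nonempty permutations $\pi$ and $\sigma$, the sum $\pi\oplus\sigma$ is the permutation of length $|\pi|+|\sigma|$ whose first $|\pi|$ entries are order isomorphic to $\pi$, whose last $|\sigma|$ entries are order isomorphic to $\sigma$, and in which all of the first $|\pi|$ entries are smaller than all of the last $|\sigma|$ entries; the skew sum $\pi\ominus\sigma$ is defined in the same way except that all of the first $|\pi|$ entries are larger than all of the last $|\sigma|$ entries. A permutation is sum indecomposable if it is not the sum of two shorter permutations, and skew indecomposable if it is not the skew sum of two shorter permutations. A regular language is a set of finite words over a finite alphabet accepted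 by a deterministic finite state automaton; the length of a word is its number of letters. A map from words to permutations is length-preserving if it sends each word of length $n$ to a permutation of length $n$. Matrices are indexed first by column (left to right) and then by row (bottom to top); a $t\times u$ matrix has $t$ columns and $u$ rows. Let $M$ be a $t\times u$ matrix with entries in $\{0,1,-1\}$. The standard figure $\Lambda$ of $M$ is the subset of $\mathbb{R}^2$ consisting of the increasing open line segment from $(k-1,\ell-1)$ to $(k,\ell)$ for each $(k,\ell)$ with $M_{k,\ell}=1$, and the decreasing open line segment from $(k-1,\ell)$ to $(k,\ell-1)$ for each $(k,\ell)$ with $M_{k,\ell}=-1$. The geometric grid class $\operatorname{Geom}(M)$ is the set of all permutations obtained as follows: choose finitely many points of $\Lambda$, no two on a common horizontal or vertical line, label them $1,\dots,n$ from bottom to top, and read the labels from left to right. A permutation class is geometrically griddable if it is contained in $\operatorname{Geom}(M)$ for some matrix $M$ with entries in $\{0,1,-1\}$. *)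

(* Defs.v *)
From mathcomp Require Import all_boot all_order all_algebra all_fingroup.
From mathcomp Require Import boolp classical_sets functions reals.

Set Implicit Arguments.
Unset Strict Implicit.
Unset Printing Implicit Defensive.

Import Order.TTheory GRing.Theory Num.Theory.

Local Open Scope classical_set_scope.
Local Open Scope ring_scope.

(* Positions and values are numbered from 0, so a permutation of length n is
   a bijection of {0, ..., n-1}. *)
Definition permutation : Type := {n : nat & 'S_n}.

Definition plen (pi : permutation) : nat := tag pi.

Definition mkperm n (pi : 'S_n) : permutation := existT (fun n => 'S_n) n pi.

Definition order_isomorphic k (s t : 'I_k -> nat) : Prop :=
  forall i j : 'I_k, (s i < s j)%N = (t i < t j)%N.

Definition contained (sigma pi : permutation) : Prop :=
  exists e : 'I_(plen sigma) -> 'I_(plen pi),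
    (forall i j : 'I_(plen sigma), (i < j)%N -> (e i < e j)%N) /\
    order_isomorphic (fun i => tagged pi (e i)) (fun i => tagged sigma i).

Definition permutation_class (C : set permutation) : Prop :=
  forall sigma pi : permutation, C pi -> contained sigma pi -> C sigma.

(* The set is empty when b < a. *)
Definition contiguous n (I : {set 'I_n}) : Prop :=
  exists a b : nat, forall i : 'I_n, (i \in I) = (a <= i <= b)%N.

Definition is_interval n (pi : 'S_n) (I : {set 'I_n}) : Prop :=
  contiguous I /\ contiguous (pi @: I).

Definition simple_perm (pi : permutation) : Prop :=
  (2 <= plen pi)%N /\
  forall I : {set 'I_(plen pi)}, is_interval (tagged pi) I ->
    [\/ #|I| = 0%N, #|I| = 1%N | #|I| = plen pi].

Definition is_sum m n (pi : 'S_m) (sigma : 'S_n) (tau : 'S_(m + n)) : Prop :=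
  [/\ order_isomorphic (fun i : 'I_m => tau (lshift n i)) (fun i => pi i),
      order_isomorphic (fun j : 'I_n => tau (rshift m j)) (fun j => sigma j)
    & forall (i : 'I_m) (j : 'I_n), (tau (lshift n i) < tau (rshift m j))%N].

Definition is_skew_sum m n (pi : 'S_m) (sigma : 'S_n) (tau : 'S_(m + n)) :
    Prop :=
  [/\ order_isomorphic (fun i : 'I_m => tau (lshift n i)) (fun i => pi i),
      order_isomorphic (fun j : 'I_n => tau (rshift m j)) (fun j => sigma j)
    & forall (i : 'I_m) (j : 'I_n), (tau (rshift m j) < tau (lshift n i))%N].

(* Both summands are nonempty, hence shorter than their sum. The empty
   permutation is therefore sum and skew indecomposable. *)
Definition sum_indecomposable (pi : permutation) : Prop :=
  ~ exists (m n : nat) (s1 : 'S_m) (s2 : 'S_n) (tau : 'S_(m + n)),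
      [/\ (0 < m)%N, (0 < n)%N, is_sum s1 s2 tau & pi = mkperm tau].

Definition skew_indecomposable (pi : permutation) : Prop :=
  ~ exists (m n : nat) (s1 : 'S_m) (s2 : 'S_n) (tau : 'S_(m + n)),
      [/\ (0 < m)%N, (0 < n)%N, is_skew_sum s1 s2 tau & pi = mkperm tau].

Record dfa (A : finType) := DFA {
  dfa_state : finType;
  dfa_start : dfa_state;
  dfa_final : {set dfa_state};
  dfa_trans : dfa_state -> A -> dfa_state
}.

Definition dfa_accepts (A : finType) (D : dfa A) (w : seq A) : bool :=
  foldl (@dfa_trans A D) (dfa_start D) w \in dfa_final D.

Definition regular_language (A : finType) (L : set (seq A)) : Prop :=
  exists D : dfa A, forall w : seq A, L w <-> dfa_accepts D w.

(* M k l is the entry in column k (from the left) and row l (from the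
   bottom): the first matrix index is the column. As indices start at 0, the
   cell of M k l is the unit square with lower left corner (k, l). *)
Definition sign_matrix t u (M : 'M[int]_(t, u)) : Prop :=
  forall (k : 'I_t) (l : 'I_u), [\/ M k l = 0, M k l = 1 | M k l = -1].

Definition standard_figure (R : realType) t u (M : 'M[int]_(t, u)) :
    set (R * R) :=
  [set p : R * R | exists (k : 'I_t) (l : 'I_u),
     k%:R < p.1 < k%:R + 1 /\
     ((M k l = 1 /\ p.2 = l%:R + (p.1 - k%:R)) \/
      (M k l = -1 /\ p.2 = l%:R + 1 - (p.1 - k%:R)))].

(* The chosen points are listed from left to right, and pi i is the label of
   the i-th one. The last two conditions make the horizontal coordinates, and
   the vertical ones, pairwise distinct. *)
Definition geom (R : realType) t u (M : 'M[int]_(t, u)) : set permutation :=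
  [set pi | exists p : 'I_(plen pi) -> R * R,
     [/\ forall i, standard_figure M (p i),
         forall i j : 'I_(plen pi), (i < j)%N -> (p i).1 < (p j).1
       & forall i j : 'I_(plen pi),
           (tagged pi i < tagged pi j)%N = ((p i).2 < (p j).2)]].

Definition geometrically_griddable (R : realType) (C : set permutation) :
    Prop :=
  exists (t u : nat) (M : 'M[int]_(t, u)),
    sign_matrix M /\ C `<=` geom R M.

Definition counting_sequence (S : set permutation) (n : nat) : nat :=
  #|[pred pi : 'S_n | `[< S (mkperm pi) >]]|.

(* The power series F = \sum_n a_n x^n equals P / Q: the coefficients of
   Q * F are those of P, and Q is invertible as a power series. *)
Definition rational_series (a : nat -> rat) : Prop :=
  exists P Q : {poly rat}, Q`_0 != 0 /\
    forall n : nat, \sum_(i < n.+1) Q`_i * a (n - i)%N = P`_n.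

(* Main.v *)
Require Import Defs.
From mathcomp Require Import all_boot all_order all_algebra all_fingroup.
From mathcomp Require Import boolp classical_sets functions reals.
From mathcomp Require Import zify lra.

Set Implicit Arguments.
Unset Strict Implicit.
Unset Printing Implicit Defensive.

Import Order.TTheory GRing.Theory Num.Theory.

(** Cut every cell of the matrix at its centre, both ways. Then each segment of
    the standard figure becomes two halves, along which the horizontal and the
    vertical distance to the centre of the cell agree
    ([standard_figure_half_cell]). List the points of a figure by increasing
    distance and record for each the half cell in which it lies. This word
    determines the permutation: a point of a right half column lies to the
    right of the earlier points of the column, a point of a left half column
    to their left, and likewise for rows ([word_perm]). So finitely many
    letters suffice to present all permutations of the class.

    A permutation has many words, for two reasons: its points may be assigned
    to cells in several ways, and for a given assignment two consecutive
    letters whose cells share neither column nor row may be exchanged. An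
    assignment comes from a word exactly if it respects the order of columns
    and rows and the order of placement that shared lines force is acyclic
    ([gridding], [gridding_self], [gridding_order]). The canonical word of a
    permutation uses the gridding that is lexicographically least from left to
    right and, for it, the lexicographic normal form of words up to exchanges
    of independent letters. Each griddable permutation has exactly one
    canonical word ([canonical_inj], [canonical_ex]).

    It remains to see that the conditions on words are regular. Regular
    properties are closed under Boolean operations and under guessing a
    colouring of the positions ([recognizable_ex]), and include each condition
    on all pairs of positions in terms of their letters and their order
    ([recognizable_all2]). A better gridding, a cycle, an interval or a
    decomposition as a sum are all colourings subject to such conditions.
    Membership in the class is inherited by subwords
    ([word_perm_subword]), and by Higman's lemma ([upset_fg]) every property
    inherited by subwords is regular ([recognizable_subword_closed]).

    Finally, the numbers of words accepted by an automaton have a rational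
    generating function by the Cayley-Hamilton theorem ([rational_accepted]). *)

(** * Recognizable properties of words *)

(** Words are handled as functions on positions, so that colourings of the
    positions of a word and relations between positions can be stated directly. *)
Definition mkword (A : Type) n (f : 'I_n -> A) : seq A := map f (enum 'I_n).

Lemma size_mkword (A : Type) n (f : 'I_n -> A) : size (mkword f) = n.
Proof. by rewrite size_map size_enum_ord. Qed.

Lemma mkword_tnth (A : Type) n (t : n.-tuple A) : mkword (tnth t) = t.
Proof. exact: map_tnth_enum. Qed.

Lemma nth_mkword (A : Type) x0 n (f : 'I_n -> A) (i : 'I_n) :
  nth x0 (mkword f) i = f i.
Proof. by rewrite (nth_map i) ?size_enum_ord // nth_ord_enum. Qed.

Lemma mkword_inj (A : Type) n : injective (@mkword A n).
Proof.
move=> f g fg; apply/funext => i.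
by rewrite -(nth_mkword (f i) f) fg nth_mkword.
Qed.

Definition recognizable (A : finType) (P : forall n, ('I_n -> A) -> Prop) :=
  exists D : dfa A, forall n (f : 'I_n -> A), P n f <-> dfa_accepts D (mkword f).

Lemma recognizable_ext (A : finType) (P Q : forall n, ('I_n -> A) -> Prop) :
  (forall n f, P n f <-> Q n f) -> recognizable P -> recognizable Q.
Proof. by move=> PQ [D HD]; exists D => n f; rewrite -PQ. Qed.

Lemma recognizable_fold (A Q : finType) (q0 : Q) (step : Q -> A -> Q)
    (F : pred Q) (P : forall n, ('I_n -> A) -> Prop) :
  (forall n (f : 'I_n -> A), P n f <-> F (foldl step q0 (mkword f))) ->
  recognizable P.
Proof.
move=> H; exists (DFA q0 [set q | F q] step) => n f.
by rewrite H /dfa_accepts inE.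
Qed.

Lemma recognizable_not (A : finType) (P : forall n, ('I_n -> A) -> Prop) :
  recognizable P -> recognizable (fun n f => ~ P n f).
Proof.
move=> [D HD].
apply: (@recognizable_fold _ _ (dfa_start D) (@dfa_trans _ D)
          (fun q => q \notin dfa_final D)) => n f.
by rewrite HD; split=> /negP.
Qed.

Lemma recognizable_and (A : finType) (P Q : forall n, ('I_n -> A) -> Prop) :
  recognizable P -> recognizable Q -> recognizable (fun n f => P n f /\ Q n f).
Proof.
move=> [D HD] [E HE].
pose step (q : dfa_state D * dfa_state E) a := (dfa_trans q.1 a, dfa_trans q.2 a).
have foldE w q : foldl step q w =
    (foldl (@dfa_trans _ D) q.1 w, foldl (@dfa_trans _ E) q.2 w).
  by elim: w q => [|a w IH] [q r] //=; rewrite IH.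
apply: (@recognizable_fold _ _ (dfa_start D, dfa_start E) step
   (fun q => (q.1 \in dfa_final D) && (q.2 \in dfa_final E))) => n f.
by rewrite HD HE foldE /=; split=> /andP.
Qed.

Lemma recognizable_or (A : finType) (P Q : forall n, ('I_n -> A) -> Prop) :
  recognizable P -> recognizable Q -> recognizable (fun n f => P n f \/ Q n f).
Proof.
move=> HP HQ; apply: (@recognizable_ext _ (fun n f => ~ (~ P n f /\ ~ Q n f))).
  by move=> n f; rewrite not_andP !notK.
by apply/recognizable_not/recognizable_and; apply: recognizable_not.
Qed.

(** A nondeterministic automaton guesses the colour of each letter as it is
    read; the subset construction makes it deterministic. *)
Lemma recognizable_ex (A B : finType)
    (P : forall n, ('I_n -> A) -> ('I_n -> B) -> Prop) :
  recognizable (fun n (h : 'I_n -> A * B) => P n (fst \o h) (snd \o h)) ->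
  recognizable (fun n f => exists g, P n f g).
Proof.
move=> [D HD].
pose step (X : {set dfa_state D}) a :=
  [set q | [exists p in X, exists b, q == dfa_trans p (a, b)]].
have foldE w X q : q \in foldl step X w <->
    exists p v, [/\ p \in X, map fst v = w & foldl (@dfa_trans _ D) p v = q].
  elim: w X => [|a w IH] X /=.
    by split=> [qX|[p [[|c v] [pX // _ <-]]]]; [exists q, [::]|].
  rewrite IH; split=> [[p [v [+ vw pq]]]|[p [[|[a' b] v] [pX //= [-> vw] pq]]]].
    rewrite inE => /existsP[r /andP[rX /existsP[b /eqP pE]]].
    by exists r, ((a, b) :: v); split; rewrite //= ?vw // -pE.
  exists (dfa_trans p (a, b)), v; split => //.
  by rewrite inE; apply/existsP; exists p; rewrite pX; apply/existsP; exists b.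
apply: (@recognizable_fold _ _ [set dfa_start D] step
   (fun X => ~~ [disjoint X & dfa_final D])) => n f; split.
  move=> [g /(HD n (fun i => (f i, g i))) acc].
  apply/pred0Pn.
  exists (foldl (@dfa_trans _ D) (dfa_start D) (mkword (fun i => (f i, g i)))).
  rewrite /= [X in _ && X]acc andbT.
  apply/foldE; exists (dfa_start D), (mkword (fun i => (f i, g i))).
  by split; rewrite ?inE // /mkword -map_comp.
case/pred0Pn=> q /= /andP[/foldE[p [v [/set1P-> vf <-]]] acc].
have sv : size v == n by rewrite -(size_mkword f) -vf size_map.
pose t := Tuple sv.
exists (snd \o tnth t).
have -> : f = fst \o tnth t.
  by apply: mkword_inj; rewrite -vf /mkword map_comp map_tnth_enum.
by apply/HD; rewrite mkword_tnth.
Qed.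

Lemma recognizable_has (A : finType) (Q : pred A) :
  recognizable (fun n (f : 'I_n -> A) => exists i, Q (f i)).
Proof.
apply: (@recognizable_fold _ _ false (fun b a => b || Q a) id) => n f.
have -> b w : foldl (fun b a => b || Q a) b w = b || has Q w.
  by elim: w b => [|a w IH] b /=; rewrite ?orbF // IH orbA.
rewrite /mkword has_map /=; split=> [[i Qi]|/hasP[i _ Qi]]; last by exists i.
by apply/hasP; exists i; rewrite ?mem_enum.
Qed.

(** It is enough to remember which letters have occurred: a new letter has to
    be compatible with each of them. *)
Lemma recognizable_pairwise (A : finType) (Q : rel A) :
  recognizable (fun n (f : 'I_n -> A) => forall i j : 'I_n, i < j -> Q (f i) (f j)).
Proof.
pose step (q : {set A} * bool) a := (a |: q.1, q.2 && [forall x in q.1, Q x a]).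
have foldE w X b : (foldl step (X, b) w).2 =
    [&& b, all (fun y => [forall x in X, Q x y]) w & pairwise Q w].
  elim: w X b => [|a w IH] X b /=; first by rewrite andbT.
  rewrite IH -!andbA; congr (_ && (_ && _)); rewrite andbA -all_predI.
  congr (_ && _); apply: eq_all => y /=; apply/forall_inP/andP => [H|[H1 H2] x].
    by split; [apply/forall_inP => x xX; apply: H; rewrite inE xX orbT
              |apply: H; rewrite setU11].
  by case/setU1P => [->//|xX]; exact: (forall_inP H1).
apply: (@recognizable_fold _ _ (finset.set0, true) step (fun q => q.2)) => n f.
rewrite foldE /=.
have -> : all (fun y => [forall x in finset.set0, Q x y]) (mkword f).
  by apply/allP => y _; apply/forall_inP => x; rewrite inE.
case: n f => [|n] f.
  by rewrite /mkword (size0nil (size_enum_ord 0)); split => // _ [].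
split=> [H|/(pairwiseP (f ord0)) H i j ij].
  apply/(pairwiseP (f ord0)) => i j; rewrite !inE size_mkword => ni nj ij.
  have := H (Ordinal ni) (Ordinal nj) ij.
  by rewrite -(nth_mkword (f ord0) f (Ordinal ni)) -(nth_mkword (f ord0) f (Ordinal nj)).
have := H i j; rewrite !nth_mkword; apply => //; by rewrite inE size_mkword.
Qed.

(** The form in which [recognizable_pairwise] is used: together with
    [recognizable_ex] it turns any condition on pairs of positions that
    mentions their letters, their colours and their order into an automaton. *)
Lemma recognizable_all2 (A : finType) (Q : bool -> rel A) :
  recognizable (fun n (f : 'I_n -> A) =>
    forall i j : 'I_n, i != j -> Q (i < j) (f i) (f j)).
Proof.
apply: recognizable_ext (recognizable_pairwise (fun a b => Q true a b && Q false b a)).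
move=> n f; split=> [H i j ij|H i j ij].
  case: (ltngtP i j) (ij) => [lt|lt|/val_inj->]; rewrite ?eqxx // => _.
    by case/andP: (H _ _ lt).
  by case/andP: (H _ _ lt).
apply/andP; split.
  by have := H i j; rewrite ij; apply; rewrite neq_ltn ij.
by have := H j i; rewrite ltnNge (ltnW ij); apply; rewrite neq_ltn ij orbT.
Qed.

(** * Higman's lemma *)

Definition upset (A : eqType) (U : set (seq A)) :=
  forall v w : seq A, subseq v w -> U v -> U w.

Definition finitely_generated (A : eqType) (U : set (seq A)) :=
  exists G : seq (seq A), forall w, U w <-> has (fun g => subseq g w) G.

(** If deleting a first letter [a] leads out of [U], then the words of [U] that
    start with [a] are generated by finitely many. Otherwise [a] may be dropped
    and induction on the length applies. *)
Lemma upset_residuals_fg (A : finType) (U : set (seq A)) : upset U ->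
  (forall a, (forall w, U (a :: w) -> U w) \/
             finitely_generated [set w | U (a :: w)]%classic) ->
  finitely_generated U.
Proof.
move=> upU Hres.
have [U0|nU0] := pselect (U [::]).
  by exists [:: [::]] => w; rewrite /= sub0seq; split=> // _; exact: upU (sub0seq w) U0.
have /choice[G HG] : forall a, exists G : seq (seq A),
    (forall g, g \in G -> U (a :: g)) /\
    forall w, U (a :: w) -> U w \/ has (fun g => subseq g w) G.
  move=> a; case: (Hres a) => [H|[G HG]]; first by exists [::]; split => // w /H; left.
  exists G; split=> [g gG|w /HG]; last by right.
  by apply/HG/hasP; exists g.
exists (flatten [seq map (cons a) (G a) | a <- enum A]) => w; split; last first.
  case/hasP=> _ /flatten_mapP[a _ /mapP[g gG ->]] sub.
  by apply: (upU _ _ sub); case: (HG a) => + _; apply.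
elim: w => [//|a w IH] Uaw.
case: (HG a) => _ /(_ _ Uaw) [/IH/hasP[g gG gw]|/hasP[g gG gw]]; apply/hasP.
  by exists g => //; apply: subseq_trans gw (subseq_cons _ _).
exists (a :: g); last by rewrite /= eqxx.
by apply/flatten_mapP; exists a; rewrite ?mem_enum //; apply: map_f.
Qed.

(** Higman's lemma for a finite alphabet, in the manner of Noetherian rings: an
    increasing union of upsets without finite generation has none either, so
    by Zorn's lemma there would be a maximal such upset. Each of its residuals
    by a letter contains it, so equals it or is finitely generated, which
    contradicts [upset_residuals_fg]. *)
Lemma upset_fg (A : finType) (U : set (seq A)) : upset U -> finitely_generated U.
Proof.
move=> upU; apply: contrapT => nfgU.
(* The union with [U] lets the empty chain, whose union is empty, through. *)
pose P (V : set (seq A)) := upset V /\ ~ finitely_generated (V `|` U)%classic.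
have upUn (V : set (seq A)) : upset V -> upset (V `|` U)%classic.
  by move=> upV v w vw [/(upV _ _ vw)|/(upU _ _ vw)]; [left|right].
have [F FP totF|V [[upV nfgV] maxV]] := @Zorn_bigcup _ P.
  split=> [v w vw [V FV Vv]|[G HG]].
    by exists V => //; apply: (FP _ FV).1 vw Vv.
  have [FV0|F0] := pselect (exists V, F V); last first.
    apply: nfgU; exists G => w; rewrite -HG; split=> [|[[V FV _]|//]]; first by right.
    by case: F0; exists V.
  have GF : forall g, g \in G -> (\bigcup_(X in F) X `|` U)%classic g.
    by move=> g gG; apply/HG/hasP; exists g.
  have [V FV GV] : exists2 V, F V & forall g, g \in G -> (V `|` U)%classic g.
    elim: G {HG} GF => [|g G IH] GF; first by case: FV0 => V FV; exists V.
    have [|V FV GV] := IH; first by move=> h hG; apply: GF; rewrite inE hG orbT.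
    have [[V' FV' V'g]|Ug] := GF g (mem_head _ _); last first.
      by exists V => // h; rewrite inE => /orP[/eqP->|/GV//]; right.
    have [VV'|V'V] := totF _ _ FV FV'.
      exists V' => // h; rewrite inE => /orP[/eqP->|/GV[/VV'|]]; by [left|left|right].
    by exists V => // h; rewrite inE => /orP[/eqP->|/GV//]; left; apply: V'V.
  case: (FP _ FV) => upV; apply; exists G => w; split=> [VUw|/hasP[g gG gw]].
    by apply/HG; case: VUw; [left; exists V|right].
  exact: (upUn _ upV) gw (GV _ gG).
apply: nfgV; apply: upset_residuals_fg => [|a]; first exact: upUn.
have [stable|nstable] := pselect (forall w,
  (V `|` U)%classic (a :: w) -> (V `|` U)%classic w).
  by left.
right; set W := [set w | _]%classic; have upW : upset W.
  by move=> v w vw; apply: (upUn _ upV); rewrite /= eqxx.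
have VUW : (V `|` U `<=` W)%classic.
  by move=> w; apply: (upUn _ upV); apply: subseq_cons.
have WU : (W `|` U)%classic = W.
  by apply/seteqP; split=> [w [//|Uw]|w]; [apply: VUW; right|left].
have : ~ P W.
  apply: maxV; split=> [w Vw|WV]; first by apply: VUW; left.
  by apply: nstable => w /WV; left.
by rewrite /P WU => /not_andP[//|/contrapT].
Qed.

(** Reading [g] greedily: the automaton for [a :: g] waits for the first [a]
    and then runs the one for [g]. *)
Lemma recognizable_subseq (A : finType) (g : seq A) :
  recognizable (fun n (f : 'I_n -> A) => subseq g (mkword f)).
Proof.
have [Q [q0 [step [F FE]]]] : exists (Q : finType) (q0 : Q) (step : Q -> A -> Q)
    (F : pred Q), forall w, F (foldl step q0 w) = subseq g w.
  elim: g => [|a g [Q [q0 [step [F FE]]]]].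
    by exists unit, tt, (fun q _ => q), xpredT => w; rewrite sub0seq.
  pose step' (q : option Q) b :=
    if q is Some q then Some (step q b) else if b == a then Some q0 else None.
  exists (option Q), None, step', (fun q => if q is Some q then F q else false).
  have foldE w q : foldl step' (Some q) w = Some (foldl step q w).
    by elim: w q => //= b w IH q; rewrite IH.
  elim=> //= b w IH; rewrite eq_sym; case: eqP => _ //; by rewrite foldE FE.
by apply: (@recognizable_fold _ _ q0 step F) => n f; rewrite FE.
Qed.

Lemma subseq_nthE (A : eqType) (x0 : A) (v w : seq A) : subseq v w ->
  exists e : nat -> nat, [/\ forall i j, i < j < size v -> e i < e j,
    forall i, i < size v -> e i < size w &
    forall i, i < size v -> nth x0 w (e i) = nth x0 v i].
Proof.
elim: w v => [|b w IH] [|a v] //=; try by exists id; split => // i j; rewrite ltn0 andbF.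
case: eqP => [->|_] /IH[e [e1 e2 e3]].
  exists (fun i => if i is i'.+1 then (e i').+1 else 0).
  split=> [[|i] [|j] //=|[|i] //|[|i] //]; rewrite !ltnS; [exact: e1|exact: e2|exact: e3].
by exists (S \o e); split=> [i j|i|i] //=; rewrite ?ltnS; [exact: e1|exact: e2|exact: e3].
Qed.

(** The words on which [P] fails form an upset, hence are those that contain
    one of finitely many words. *)
Lemma recognizable_subword_closed (A : finType) (P : forall n, ('I_n -> A) -> Prop) :
  (forall m n (g : 'I_n -> A) (e : 'I_m -> 'I_n),
     (forall i j : 'I_m, i < j -> e i < e j) -> P n g -> P m (g \o e)) ->
  recognizable P.
Proof.
move=> closedP.
pose U (w : seq A) := exists n (f : 'I_n -> A), w = mkword f /\ ~ P n f.
have UE n (f : 'I_n -> A) : U (mkword f) <-> ~ P n f.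
  split=> [[m [g [fg nPg]]]|]; last by exists n, f.
  have mn : m = n by rewrite -(size_mkword g) -fg size_mkword.
  by subst m; rewrite (mkword_inj fg).
have upU : upset U.
  move=> v w vw [m [f [vf nPf]]].
  rewrite -[w](mkword_tnth (in_tuple w)); apply/UE => Pw; apply: nPf.
  case: m f vf => [|m] f vf.
    have -> : f = tnth (in_tuple w) \o (fun i : 'I_0 => False_rect _ (notF (ltn_ord i))).
      by apply/funext => -[].
    by apply: closedP Pw => -[].
  have [e [e1 e2 e3]] := subseq_nthE (f ord0) vw.
  have sv : size v = m.+1 by rewrite vf size_mkword.
  have e2' (i : 'I_m.+1) : e i < size w by apply: e2; rewrite sv.
  have -> : f = tnth (in_tuple w) \o (fun i => Ordinal (e2' i)).
    apply/funext => i; rewrite /= (tnth_nth (f ord0)) /= e3 ?sv //.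
    by rewrite vf nth_mkword.
  apply: (closedP _ _ _ (fun i => Ordinal (e2' i)) _ Pw) => i j ij /=.
  by apply: e1; rewrite ij sv ltn_ord.
have [G HG] := upset_fg upU.
apply: (@recognizable_ext _ (fun n f => ~ has (fun g => subseq g (mkword f)) G)).
  by move=> n f; rewrite -HG UE notK.
apply: recognizable_not; elim: {HG} G => [|g G IH] /=.
  by apply: (@recognizable_fold _ unit tt (fun q _ => q) xpred0) => n f; split.
apply: recognizable_ext (recognizable_or (recognizable_subseq g) IH) => n f /=.
by split=> /orP.
Qed.

(** * Counting accepted words *)

Lemma card_accepted_recl (A : finType) (P : seq A -> bool) n :
  #|[pred t : n.+1.-tuple A | P t]| = \sum_a #|[pred t : n.-tuple A | P (a :: t)]|.
Proof.
rewrite -sum1_card big_mkcond /=.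
rewrite (reindex (fun at_ : A * n.-tuple A => cons_tuple at_.1 at_.2)) /=; last first.
  exists (fun t : n.+1.-tuple A => (thead t, behead_tuple t)) => [[a t] _|t _] /=.
    by congr pair; apply: val_inj.
  by apply: val_inj; rewrite [in RHS](tuple_eta t).
rewrite -(pair_bigA _ (fun a (t : n.-tuple A) => if P (a :: t) then 1 else 0)) /=.
by apply: eq_bigr => a _; rewrite -big_mkcond sum1_card.
Qed.

Local Open Scope ring_scope.

(** The numbers of accepted words are the entries of the powers of the transfer
    matrix applied to a vector, so by the Cayley-Hamilton theorem they satisfy
    the linear recurrence given by its characteristic polynomial. *)
Lemma rational_accepted (A : finType) (D : dfa A) :
  rational_series (fun n => #|[pred t : n.-tuple A | dfa_accepts D t]|%:R).
Proof.
pose count n q := #|[pred t : n.-tuple A | foldl (@dfa_trans _ D) q t \in dfa_final D]|.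
set Q := dfa_state D in count *.
have [m [idx [st [idxK stK]]]] : exists m (idx : Q -> 'I_m.+1) (st : 'I_m.+1 -> Q),
    cancel idx st /\ cancel st idx.
  have E : #|Q|.-1.+1 = #|Q| by apply: prednK; apply/card_gt0P; exists (dfa_start D).
  exists #|Q|.-1, (fun q => cast_ord (esym E) (enum_rank q)),
    (fun i => enum_val (cast_ord E i)).
  split=> [q|i]; rewrite ?cast_ordKV ?enum_rankK //.
  by rewrite enum_valK cast_ordK.
pose M : 'M[rat]_m.+1 := \matrix_(p, q) #|[pred a | dfa_trans (st p) a == st q]|%:R.
pose v n : 'cV[rat]_m.+1 := \col_p (count n (st p))%:R.
have vS n : v n.+1 = M *m v n.
  apply/matrixP => p k; rewrite !mxE /count.
  rewrite (card_accepted_recl (fun t => foldl (@dfa_trans _ D) (st p) t \in _)) natr_sum /=.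
  rewrite (partition_big (fun a => idx (dfa_trans (st p) a)) xpredT) //=.
  apply: eq_bigr => q _; rewrite !mxE.
  rewrite (eq_bigr (fun=> (count n (st q))%:R)) => [|a /eqP <-]; last by rewrite idxK.
  rewrite sumr_const mulrC mulr_natr; congr (_ *+ _).
  by apply: eq_card => a; rewrite !inE -[RHS](inj_eq (can_inj idxK)) stK.
have vX n k : v (n + k)%N = M ^+ k *m v n.
  elim: k => [|k IH]; first by rewrite addn0 expr0 mul1mx.
  by rewrite addnS vS IH exprS mulmxA.
pose chi := char_poly M.
have rec (n : nat) : \sum_(k < m.+2) chi`_k * (count (n + k)%N (dfa_start D))%:R = 0.
  have := congr1 (fun B => (B *m v n) (idx (dfa_start D)) ord0) (Cayley_Hamilton M).
  rewrite mul0mx [RHS]mxE => CH; rewrite -[RHS]CH.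
  rewrite -/chi [in RHS](_ : chi = \poly_(k < m.+2) chi`_k); last first.
    by rewrite -{1}(size_char_poly M) coefK.
  rewrite poly_def raddf_sum /= mulmx_suml summxE; apply: eq_bigr => k _.
  by rewrite linearZ /= rmorphXn /= horner_mx_X -scalemxAl -vX !mxE idxK.
(* The denominator is the reversed characteristic polynomial. *)
pose q : {poly rat} := \poly_(i < m.+2) chi`_(m.+1 - i)%N.
pose a (n : nat) : rat := (count n (dfa_start D))%:R.
pose p : {poly rat} := \poly_(n < m.+1) \sum_(i < n.+1) q`_i * a (n - i)%N.
exists p, q; split.
  rewrite coef_poly /= subn0.
  have /monicP := char_poly_monic M; rewrite lead_coefE size_char_poly /= => ->.
  exact: oner_neq0.
move=> n; rewrite [in RHS]coef_poly; case: ltnP => // mn.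
rewrite -[RHS](rec (n - m.+1)%N) [in RHS](reindex_inj rev_ord_inj) /=.
transitivity (\sum_(0 <= i < n.+1) q`_i * a (n - i)%N); first by rewrite big_mkord.
rewrite (@big_cat_nat _ _ _ m.+2) //= [X in _ + X]big_nat_cond [X in _ + X]big1 ?addr0.
  rewrite big_mkord; apply: eq_bigr => i _.
  by rewrite coef_poly ltn_ord subSS; congr (_ * (count _ _)%:R); have := ltn_ord i; lia.
by move=> i /andP[/andP[mi _] _]; rewrite coef_poly ltnNge mi mul0r.
Qed.
Local Close Scope ring_scope.

(** * Griddings and normal forms *)

Section Griddings.
Variables (A : finType) (c r : A -> nat).

(** The cells of a grid are the letters of [A], and [c] and [r] are their
    columns and rows. Points of the same column or row constrain each other. *)
Definition dependent (a b : A) := (c a == c b) || (r a == r b).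

(** A line (column or row) with an odd number is traversed in the direction of
    the axis, one with an even number in the opposite direction. *)
Definition along (k : nat) (b b' : bool) := if odd k then b else b'.

(** The points of a permutation are compared by [kx] from left to right and by
    [ky] from bottom to top, and [h] puts them into cells. Then [before i j]
    means that a line shared by [i] and [j] forces [i] to be placed before
    [j]. *)
Definition before (T : finType) (kx ky : T -> nat) (h : T -> A) (i j : T) :=
  ((c (h i) == c (h j)) && along (c (h i)) (kx i < kx j) (kx j < kx i)) ||
  ((r (h i) == r (h j)) && along (r (h i)) (ky i < ky j) (ky j < ky i)).

(** On a finite type, having a source in each nonempty subset amounts to having
    no cycle. *)
Definition acyclic (T : finType) (D : rel T) :=
  forall Z : pred T, (exists z, Z z) -> exists z, Z z /\ forall z', Z z' -> ~~ D z' z.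

(** Acyclicity is the geometric part: it says that the points can be placed in
    some order. Without it this would be a monotone gridding. *)
Definition gridding (T : finType) (kx ky : T -> nat) (h : T -> A) :=
  [/\ forall i j, kx i < kx j -> c (h i) <= c (h j),
      forall i j, ky i < ky j -> r (h i) <= r (h j)
    & acyclic (before kx ky h)].

Lemma before_dependent (T : finType) (kx ky : T -> nat) h i j :
  before kx ky h i j -> dependent (h i) (h j).
Proof. by rewrite /dependent => /orP[] /andP[-> _]; rewrite ?orbT. Qed.

Lemma dependent_before (T : finType) (kx ky : T -> nat) h i j :
  injective kx -> injective ky -> i != j -> dependent (h i) (h j) ->
  before kx ky h i j || before kx ky h j i.
Proof.
move=> kxI kyI ij; rewrite /dependent /before /along.
have: kx i != kx j by rewrite (inj_eq kxI).
have: ky i != ky j by rewrite (inj_eq kyI).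
rewrite !neq_ltn => Hy Hx /orP[/eqP E|/eqP E]; rewrite !E !eqxx /=.
  by case: (odd (c _)); case/orP: Hx => ->; rewrite ?orbT.
by case: (odd (r _)); case/orP: Hy => ->; rewrite ?orbT.
Qed.

(** The lexicographic normal form of traces: a word is normal when no letter can
    be moved to the left, across letters independent of it, to stand before a
    larger letter. The set [F] collects the letters that could be moved like
    that if they came next. *)
Fixpoint normal (F : {set A}) (w : seq A) :=
  if w is a :: w' then
    (a \notin F) &&
    normal [set b | ~~ dependent a b && ((b \in F) || (enum_rank b < enum_rank a))] w'
  else true.

Lemma normalS (F F' : {set A}) w : F \subset F' -> normal F' w -> normal F w.
Proof.
elim: w F F' => //= a w IH F F' FF' /andP[aF' /(IH _ _ _) nw].
rewrite (contra (fintype.subsetP FF' a)) //=; apply: nw; apply/fintype.subsetP => b.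
by rewrite !inE => /andP[-> /orP[/(fintype.subsetP FF')->|->]]; rewrite ?orbT.
Qed.

Lemma normal_late (F : {set A}) u a w : a \in F ->
  all (fun b => ~~ dependent b a) u -> ~~ normal F (u ++ a :: w).
Proof.
elim: u F => [|b u IH] F aF /=; first by rewrite aF.
by move=> /andP[ba ua]; rewrite negb_and IH ?orbT // inE ba aF.
Qed.

(** Always take, among the points without a predecessor, one with the least
    letter. *)
Lemma greedy_order (T : finType) (D : rel T) (h : T -> A) :
  (forall i j, D i j -> dependent (h i) (h j)) -> acyclic D ->
  exists s : seq T, [/\ uniq s, forall x, x \in s,
    pairwise (fun x y => ~~ D y x) s & normal finset.set0 (map h s)].
Proof.
move=> Ddep Dac.
(* A letter of [F] must not come up, so each point with such a letter has to be
   held back by a predecessor; this is inherited by the remaining points. *)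
suff [s [s1 s2 s3 s4]] : exists s : seq T, [/\ uniq s, s =i [set: T],
    pairwise (fun x y => ~~ D y x) s &
    forall F : {set A}, (forall y, y \in [set: T] -> h y \in F ->
      exists2 z, z \in [set: T] & D z y) -> normal F (map h s)].
  exists s; split=> // [x|]; first by rewrite s2 inE.
  by apply: s4 => y _; rewrite inE.
move: [set: T] => Z; elim: {Z}_.+1 {-2}Z (ltnSn #|Z|) => // m IH Z.
have [->|[z0 z0Z]] := set_0Vmem Z.
  by exists [::]; split => // x; rewrite in_nil finset.in_set0.
rewrite ltnS => Zm.
pose minimal z := (z \in Z) && [forall z' in Z, ~~ D z' z].
have [x0 mx0] : exists z, minimal z.
  have [|z [zZ Hz]] := Dac (mem Z); first by exists z0.
  by exists z; apply/andP; split => //; apply/forall_inP.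
case: (arg_minnP (fun z => enum_rank (h z) : nat) mx0)
  => x /andP[xZ /forall_inP xmin] xleast.
have [|s [s1 s2 s3 s4]] := IH (Z :\ x).
  by apply: leq_trans Zm; rewrite [leqRHS](cardsD1 x) xZ.
exists (x :: s); split=> [|y||F HF] /=.
- by rewrite s1 s2 !inE eqxx.
- by rewrite inE s2 !inE; case: eqP => // ->; rewrite xZ.
- by rewrite s3 andbT; apply/allP => y; rewrite s2 !inE => /andP[_ yZ]; apply: xmin.
apply/andP; split.
  by apply/negP => /(HF _ xZ)[z zZ]; apply/negP; apply: xmin.
apply: s4 => y; rewrite !inE => /andP[yx yZ] /andP[indep Fy].
suff [z zZ Dzy] : exists2 z, z \in Z & D z y.
  exists z => //; rewrite !inE zZ andbT; apply: contraNneq indep => <-.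
  exact: Ddep.
case/orP: Fy => [/(HF _ yZ)//|lt].
have : ~~ minimal y by apply: contraTN lt => /xleast; rewrite -leqNgt.
by rewrite negb_and yZ => /forall_inPn[z zZ /negPn Dzy]; exists z.
Qed.

(** Two orders of the same points: where they first differ, the point that one
    of them takes next occurs later in the other one, behind points that are
    independent of it. So the order whose next letter is the larger one is not
    normal. *)
Lemma normal_order_unique (T : finType) (D : rel T) (h : T -> A) s1 s2 :
  (forall i j, i != j -> dependent (h i) (h j) -> D i j || D j i) ->
  uniq s1 -> perm_eq s1 s2 ->
  pairwise (fun x y => ~~ D y x) s1 -> pairwise (fun x y => ~~ D y x) s2 ->
  normal finset.set0 (map h s1) -> normal finset.set0 (map h s2) -> s1 = s2.
Proof.
move=> Dtot.
(* In the second order [x1] could be moved to the front. *)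
have front x1 x2 t1 t2 : x1 != x2 -> uniq (x1 :: t1) ->
    perm_eq (x1 :: t1) (x2 :: t2) -> all (fun y => ~~ D y x1) t1 ->
    pairwise (fun x y => ~~ D y x) (x2 :: t2) ->
    normal finset.set0 (map h (x2 :: t2)) ->
    ~~ dependent (h x2) (h x1) /\ ~~ (enum_rank (h x1) < enum_rank (h x2)).
  move=> neq u1 s12 min1 ord2 nf2.
  have x1t2 : x1 \in t2.
    by have := perm_mem s12 x1; rewrite !inE eqxx (negPf neq).
  move: s12 ord2 nf2; case/splitPr: x1t2 => u v s12 ord2 nf2.
  have indep y : y \in x2 :: u -> ~~ dependent (h y) (h x1).
    move=> yu; have yx1 : y != x1.
      have := u1; rewrite (perm_uniq s12) -cat_cons cat_uniq /= negb_or.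
      by case/and3P=> _ /andP[x1u _] _; apply: contraNneq x1u => <-.
    apply: contraT => /negPn/(Dtot _ _ yx1) /orP[Dy|Dy].
      have : y \in x1 :: t1 by rewrite (perm_mem s12) -cat_cons mem_cat yu.
      by rewrite inE (negPf yx1) => /(allP min1); rewrite Dy.
    have := ord2; rewrite -cat_cons pairwise_cat => /and3P[/allrelP H _ _].
    by have := H _ x1 yu (mem_head _ _); rewrite Dy.
  split; first by apply: indep; rewrite mem_head.
  apply: contraTN nf2 => lt; rewrite /= negb_and; apply/orP; right.
  rewrite map_cat /=; apply: normal_late.
    by rewrite !inE lt orbT indep // mem_head.
  by apply/allP => _ /mapP[y yu ->]; apply: indep; rewrite inE yu orbT.
elim: s1 s2 => [|x1 t1 IH] [|x2 t2] u1 s12; try by have := perm_size s12.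
move=> o1 o2 n1 n2; have [eq12|neq] := eqVneq x1 x2.
  subst x2; congr cons; apply: IH.
  - by case/andP: u1.
  - by rewrite -(perm_cons x1).
  - by case/andP: o1.
  - by case/andP: o2.
  - by apply: normalS (finset.sub0set _) (proj2 (andP n1)).
  - by apply: normalS (finset.sub0set _) (proj2 (andP n2)).
have [ind lt12] := front _ _ _ _ neq u1 s12 (proj1 (andP o1)) o2 n2.
have [_ lt21] : ~~ dependent (h x1) (h x2) /\ ~~ (enum_rank (h x2) < enum_rank (h x1)).
  apply: front (proj1 (andP o2)) o1 n1;
    rewrite 1?eq_sym // ?[perm_eq (x2 :: _) _]perm_sym //.
  by rewrite -(perm_uniq s12).
suff E : h x1 = h x2 by rewrite /dependent E eqxx in ind.
by apply: enum_rank_inj; apply: ord_inj; apply/eqP; rewrite eqn_leq leqNgt lt21 leqNgt lt12.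
Qed.

(** Comparing griddings from left to right makes the comparison depend on the
    permutation only, not on a word that presents it. *)
Definition lex_before (T : finType) (kx : T -> nat) (h g : T -> A) :=
  exists p, enum_rank (h p) < enum_rank (g p) /\ forall q, kx q < kx p -> h q = g q.

Lemma lex_total (T : finType) (kx : T -> nat) (h g : T -> A) :
  injective kx -> [\/ h = g, lex_before kx h g | lex_before kx g h].
Proof.
move=> kxI; have [/existsP[p0 np0]|/existsPn E] := boolP [exists p, h p != g p].
  case: (arg_minnP (P := fun p => h p != g p) kx np0) => p np pmin.
  have eqb q : kx q < kx p -> h q = g q.
    by move=> qp; apply: contraTeq qp => /pmin; rewrite -leqNgt.
  case: (ltngtP (enum_rank (h p)) (enum_rank (g p))) => lt.
  - by apply: Or32; exists p.
  - by apply: Or33; exists p; split => // q /eqb.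
  - by move: np; rewrite (enum_rank_inj (ord_inj lt)) eqxx.
by apply: Or31; apply/funext => p; apply/eqP/negPn; rewrite E.
Qed.

Lemma lex_minimal (T : finType) (kx : T -> nat) (P : (T -> A) -> Prop) :
  injective kx -> (exists h, P h) ->
  exists h, P h /\ ~ exists g, P g /\ lex_before kx g h.
Proof.
move=> kxI [h0 Ph0].
have irr h : ~ lex_before kx h h by case=> p []; rewrite ltnn.
have trans g h k : lex_before kx g h -> lex_before kx h k -> lex_before kx g k.
  move=> [p [p1 p2]] [q [q1 q2]]; case: (ltngtP (kx p) (kx q)) => lt.
  - exists p; split; first by rewrite -(q2 _ lt).
    by move=> x xp; rewrite p2 // q2 // (ltn_trans xp).
  - exists q; split; first by rewrite (p2 _ lt).
    by move=> x xq; rewrite p2 ?(ltn_trans xq) // q2.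
  - have pq := kxI _ _ lt; subst q; exists p; split; first exact: ltn_trans q1.
    by move=> x xp; rewrite p2 // q2.
(* A minimal element is one with the fewest elements below it. *)
pose below (h : {ffun T -> A}) :=
  [set g : {ffun T -> A} | `[< P g /\ lex_before kx g h >]].
have Pf0 : `[< P (finfun h0) >].
  apply/asboolP; rewrite (_ : fun_of_fin _ = h0) //.
  by apply/funext => x; rewrite ffunE.
case: (arg_minnP (P := fun h : {ffun T -> A} => `[< P h >])
  (fun h => #|below h|) Pf0) => h /asboolP Ph hmin.
exists h; split => // -[g [Pg gh]].
have gE : g = finfun g :> (T -> A) by apply/funext => x; rewrite ffunE.
have := hmin (finfun g); rewrite -gE => /(_ (asboolT Pg)); rewrite leqNgt => /negP; apply.
apply: proper_card; apply/properP; split.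
  apply/fintype.subsetP => k; rewrite /below !inE -gE => -[Pk kg]; split => //.
  exact: trans kg gh.
exists (finfun g); rewrite /below inE -?gE; first exact/asboolP.
by apply/asboolP => -[_]; apply: irr.
Qed.

End Griddings.

(** * The permutation of a word *)

(** The coordinate of the [i]-th of [n] points on line [k]: the lines are
    disjoint blocks of [n] coordinates, and even lines are filled backwards. *)
Definition coord (n k i : nat) := k * n + (if odd k then i else n - i.+1).

Lemma ltn_coord n k l i j : i < n -> j < n ->
  (coord n k i < coord n l j) =
  (k < l) || ((k == l) && (if odd k then i < j else j < i)).
Proof.
move=> ni nj; rewrite /coord; case: (ltngtP k l) => [kl|lk|<-] /=.
- have : k.+1 * n <= l * n by rewrite leq_mul2r kl orbT.
  by rewrite mulSn; case: (odd k); case: (odd l); lia.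
- have : l.+1 * n <= k * n by rewrite leq_mul2r lk orbT.
  by rewrite mulSn; case: (odd k); case: (odd l); lia.
- by case: (odd k); lia.
Qed.

Lemma coord_inj n (lab : 'I_n -> nat) : injective (fun i => coord n (lab i) i).
Proof.
move=> i j /eqP; rewrite eqn_leq leqNgt [X in _ && X]leqNgt !ltn_coord //.
case: (ltngtP (lab i) (lab j)) => //= <-.
case: odd; case: (ltngtP i j) => //= ij _; exact: val_inj.
Qed.

(** If the labels grow with [k], and on each line the indices follow its
    direction, then [coord] recovers the order [k]. *)
Lemma coord_sorted n (k lab : 'I_n -> nat) : injective k ->
  (forall i j, k i < k j -> lab i <= lab j) ->
  (forall i j : 'I_n, i < j -> lab i = lab j ->
     ~~ along (lab i) (k j < k i) (k i < k j)) ->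
  forall i j : 'I_n, (coord n (lab i) i < coord n (lab j) j) = (k i < k j).
Proof.
move=> kI mono sorted i j; rewrite ltn_coord //.
have [<-|ij] := eqVneq i j; first by rewrite !ltnn eqxx; case: odd.
have kij : k i != k j by rewrite (inj_eq kI).
case: (ltngtP (lab i) (lab j)) => [lt|lt|eq] /=.
- case: (ltngtP (k i) (k j)) kij => // /mono; by rewrite leqNgt lt.
- by case: (ltngtP (k i) (k j)) kij => // /mono; rewrite leqNgt lt.
case: (ltngtP i j) ij => [lt|lt|/val_inj->] _; last by rewrite !ltnn; case: odd.
  have := sorted _ _ lt eq; rewrite /along.
  by case: odd; case: (ltngtP (k i) (k j)) kij.
have := sorted _ _ lt (esym eq); rewrite /along -eq.
by case: odd; case: (ltngtP (k i) (k j)) kij.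
Qed.

(** The entry at [i] is the number of smaller values. *)
Lemma standardization n (k : 'I_n -> nat) : injective k ->
  exists s : 'S_n, forall i j, (s i < s j) = (k i < k j).
Proof.
move=> kI.
pose rk i := #|[set j | k j < k i]|.
have rk_lt i : rk i < n.
  rewrite -[ltnRHS]card_ord -cardsT; apply: proper_card; apply/properP.
  by split; [apply: finset.subsetT|exists i; rewrite !inE ?ltnn].
have rk_mono i j : k i < k j -> rk i < rk j.
  move=> ij; apply: proper_card; apply/properP; split.
    by apply/fintype.subsetP => l; rewrite !inE => /ltn_trans; apply.
  by exists i; rewrite !inE ?ltnn.
have rkE i j : (rk i < rk j) = (k i < k j).
  case: (ltngtP (k i) (k j)) => [/rk_mono//|/rk_mono|/kI->]; last by rewrite ltnn.
  by case: ltngtP.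
have rkI : injective (fun i => Ordinal (rk_lt i)).
  move=> i j /(congr1 val) /= E; apply: kI; apply/eqP.
  by rewrite eqn_leq leqNgt -rkE E ltnn leqNgt -rkE E ltnn.
by exists (perm rkI) => i j; rewrite !permE /= rkE.
Qed.

Lemma perm_order_inj n (s t : 'S_n) : (forall i j, (s i < s j) = (t i < t j)) -> s = t.
Proof.
move=> st.
have card_below (u : 'S_n) i : #|[set j | u j < u i]| = u i.
  rewrite -(card_imset _ (@perm_inj _ u)).
  transitivity #|[set k : 'I_n | k < u i]|.
    apply: eq_card => k; rewrite inE; apply/imsetP/idP => [[j + ->]|ki].
      by rewrite inE.
    by exists (u^-1%g k); rewrite ?inE permKV.
  rewrite -sum1_card (eq_bigl (fun k : 'I_n => k < u i)) => [|k]; last by rewrite inE.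
  by rewrite big_ord_narrow ?sum1_card ?card_ord // ltnW.
apply/permP => i; apply: val_inj; rewrite /= -(card_below s) -(card_below t).
by apply: eq_card => j; rewrite !inE st.
Qed.

Section Words.
Variables (A : finType) (c r : A -> nat).

Definition xkey n (f : 'I_n -> A) (i : 'I_n) := coord n (c (f i)) i.
Definition ykey n (f : 'I_n -> A) (i : 'I_n) := coord n (r (f i)) i.

Lemma xkey_inj n (f : 'I_n -> A) : injective (xkey f).
Proof. exact: coord_inj. Qed.

Lemma ykey_inj n (f : 'I_n -> A) : injective (ykey f).
Proof. exact: coord_inj. Qed.

(** Position [i] of the word [f] is the point at index [e i] of [pi]. *)
Definition pictures n (f : 'I_n -> A) (e pi : 'S_n) :=
  forall i j, (e i < e j) = (xkey f i < xkey f j) /\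
              (pi (e i) < pi (e j)) = (ykey f i < ykey f j).

Lemma pictures_ex n (f : 'I_n -> A) : exists pi e, pictures f e pi.
Proof.
have [e eE] := standardization (@xkey_inj _ f).
have [s sE] := standardization (@ykey_inj _ f).
by exists (e^-1 * s)%g, e => i j; rewrite eE !permM !permK sE.
Qed.

Lemma pictures_unique n (f : 'I_n -> A) e pi e' pi' :
  pictures f e pi -> pictures f e' pi' -> e = e' /\ pi = pi'.
Proof.
move=> H H'.
have E : e = e' by apply: perm_order_inj => i j; rewrite (H i j).1 (H' i j).1.
subst e'; split => //; apply: (@mulgI _ e); apply: perm_order_inj => i j.
by rewrite !permM (H i j).2 (H' i j).2.
Qed.

Definition word_perm n (f : 'I_n -> A) : 'S_n := sval (cid (pictures_ex f)).

Lemma word_permP n (f : 'I_n -> A) : exists e, pictures f e (word_perm f).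
Proof. by rewrite /word_perm; case: cid. Qed.

Lemma word_perm_eq n (f : 'I_n -> A) e pi : pictures f e pi -> word_perm f = pi.
Proof. by case: (word_permP f) => e' H' /(pictures_unique H')[]. Qed.

Lemma before_ltn n (f : 'I_n -> A) i j :
  before c r (xkey f) (ykey f) f i j -> i < j.
Proof.
rewrite /before /xkey /ykey !ltn_coord // /along.
by case/orP=> /andP[/eqP->]; rewrite !ltnn !eqxx /=; case: odd.
Qed.

Lemma gridding_self n (f : 'I_n -> A) : gridding c r (xkey f) (ykey f) f.
Proof.
split=> [i j|i j|Z [z0 Z0]].
- by rewrite /xkey ltn_coord // => /orP[/ltnW//|/andP[/eqP->]].
- by rewrite /ykey ltn_coord // => /orP[/ltnW//|/andP[/eqP->]].
case: (arg_minnP (fun i : 'I_n => i : nat) Z0) => z Zz zmin.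
exists z; split => // z' /zmin.
by rewrite leqNgt; apply: contra; apply: before_ltn.
Qed.

(** Placing the points of a gridding in a greedy order gives a normal word for
    the same permutation. *)
Lemma gridding_order n (kx ky : 'I_n -> nat) (h : 'I_n -> A) :
  injective kx -> injective ky -> gridding c r kx ky h ->
  exists e : 'S_n, [/\
      forall i j, (xkey (h \o e) i < xkey (h \o e) j) = (kx (e i) < kx (e j)),
      forall i j, (ykey (h \o e) i < ykey (h \o e) j) = (ky (e i) < ky (e j))
    & normal c r finset.set0 (mkword (h \o e))].
Proof.
move=> kxI kyI [hx hy hac].
have [s [us sT so sn]] := greedy_order (@before_dependent _ c r _ kx ky h) hac.
have ss : size s == n.
  apply/eqP; rewrite -[RHS]size_enum_ord; apply/perm_size/uniq_perm; rewrite ?enum_uniq //.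
  by move=> x; rewrite sT mem_enum.
pose t := Tuple ss.
have tI : injective (tnth t) by apply/tuple_uniqP.
pose e := perm tI.
have eo (i j : 'I_n) : i < j -> ~~ before c r kx ky h (e j) (e i).
  move=> ij; have := so; rewrite -[s]/(tval t) -(mkword_tnth t) /mkword.
  move/(pairwiseP (e i)) => /(_ i j); rewrite !inE size_mkword !ltn_ord.
  by rewrite !nth_mkword !permE; apply.
exists e; split.
- apply: coord_sorted => [|i j /hx//|i j ij E]; first exact: inj_comp kxI (@perm_inj _ e).
  by have := eo _ _ ij; rewrite /before negb_or /= E eqxx => /andP[].
- apply: coord_sorted => [|i j /hy//|i j ij E]; first exact: inj_comp kyI (@perm_inj _ e).
  by have := eo _ _ ij; rewrite /before negb_or /= E eqxx => /andP[].
suff -> : mkword (h \o e) = map h s by [].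
rewrite -[s]/(tval t) -(mkword_tnth t) /mkword -[RHS]map_comp.
by apply: eq_map => i; rewrite /= permE.
Qed.

Lemma normal_word_unique n (f f' : 'I_n -> A) (e : 'S_n) :
  (forall i j, (xkey f' (e i) < xkey f' (e j)) = (xkey f i < xkey f j)) ->
  (forall i j, (ykey f' (e i) < ykey f' (e j)) = (ykey f i < ykey f j)) ->
  f' \o e = f -> normal c r finset.set0 (mkword f) ->
  normal c r finset.set0 (mkword f') ->
  f = f'.
Proof.
move=> Ex Ey fe nf nf'.
suff E : map e (enum 'I_n) = enum 'I_n.
  rewrite -fe; apply/funext => i /=; congr f'.
  by rewrite -(nth_mkword i e i) /mkword E nth_ord_enum.
pose D := before c r (xkey f') (ykey f') f'.
have ord_sorted : pairwise (fun i j : 'I_n => i < j) (enum 'I_n).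
  have := iota_ltn_sorted 0 n.
  by rewrite (sorted_pairwise ltn_trans) -val_enum_ord pairwise_map.
have ue : uniq (map e (enum 'I_n)) by rewrite map_inj_uniq ?enum_uniq //; apply: perm_inj.
apply: (@normal_order_unique _ c r _ D f').
- by move=> i j ij; apply: dependent_before ij; [apply: xkey_inj|apply: ykey_inj].
- exact: ue.
- apply: uniq_perm; rewrite ?ue ?enum_uniq // => x.
  rewrite [RHS]mem_enum; apply/mapP; exists (e^-1%g x); rewrite ?mem_enum ?permKV //.
- rewrite pairwise_map; apply: sub_pairwise ord_sorted => i j /=.
  rewrite ltnNge; apply: contra.
  have -> : D (e j) (e i) = before c r (xkey f) (ykey f) f j i.
    by rewrite /D /before !Ex !Ey -fe.
  by move/before_ltn/ltnW.
- apply: sub_pairwise ord_sorted => i j /=; rewrite ltnNge; apply: contra.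
  by move/before_ltn/ltnW.
- by rewrite -map_comp -/(mkword _) fe.
- by [].
Qed.

(** Normal words are unique for a given gridding; requiring the gridding to be
    lexicographically least makes them unique for a given permutation. *)
Definition canonical n (f : 'I_n -> A) :=
  normal c r finset.set0 (mkword f) /\
  ~ exists h, gridding c r (xkey f) (ykey f) h /\ lex_before (xkey f) h f.

Lemma gridding_comp (T T' : finType) (kx ky : T -> nat) (kx' ky' : T' -> nat)
    (e : T -> T') h :
  (forall i j, (kx' (e i) < kx' (e j)) = (kx i < kx j)) ->
  (forall i j, (ky' (e i) < ky' (e j)) = (ky i < ky j)) ->
  gridding c r kx' ky' h -> gridding c r kx ky (h \o e).
Proof.
move=> Ex Ey [hx hy hac]; split=> [i j|i j|Z [z Zz]].
- by rewrite -Ex => /hx.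
- by rewrite -Ey => /hy.
have [|z' [/existsP[z1 /andP[/eqP<- Zz1]] Hz]] :=
  hac (fun y => [exists x, (e x == y) && Z x]).
  by exists (e z); apply/existsP; exists z; rewrite eqxx.
exists z1; split => // z2 Zz2; have := Hz (e z2).
rewrite /before /= !Ex !Ey; apply.
by apply/existsP; exists z2; rewrite eqxx.
Qed.

Lemma lex_before_comp n (kx kx' : 'I_n -> nat) (e : 'S_n) (h g : 'I_n -> A) :
  (forall i j, (kx' (e i) < kx' (e j)) = (kx i < kx j)) ->
  lex_before kx' h g -> lex_before kx (h \o e) (g \o e).
Proof.
move=> Ex [p [p1 p2]]; exists (e^-1%g p); rewrite /= permKV; split => // q.
by rewrite -Ex permKV => /p2.
Qed.

(** Each of the two words carries its gridding over to the other one. By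
    minimality the griddings agree, and then so do the normal words. *)
Lemma canonical_inj n (f f' : 'I_n -> A) :
  canonical f -> canonical f' -> word_perm f = word_perm f' -> f = f'.
Proof.
move=> [nf cf] [nf' cf'] ff'.
have [e1 H1] := word_permP f; have [e2 H2] := word_permP f'.
pose e := (e1 * e2^-1)%g.
have Ex i j : (xkey f' (e i) < xkey f' (e j)) = (xkey f i < xkey f j).
  by rewrite -(H2 _ _).1 -(H1 _ _).1 /e !permM !permKV.
have Ey i j : (ykey f' (e i) < ykey f' (e j)) = (ykey f i < ykey f j).
  by rewrite -(H2 _ _).2 -(H1 _ _).2 /e !permM !permKV ff'.
have Ex' i j : (xkey f (e^-1%g i) < xkey f (e^-1%g j)) = (xkey f' i < xkey f' j).
  by rewrite -Ex !permKV.
have Ey' i j : (ykey f (e^-1%g i) < ykey f (e^-1%g j)) = (ykey f' i < ykey f' j).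
  by rewrite -Ey !permKV.
apply: (normal_word_unique Ex Ey) => //.
case: (lex_total (f' \o e) f (@xkey_inj _ f)) => // lt; exfalso.
  by apply: cf; exists (f' \o e); split => //; apply: gridding_comp Ex Ey (gridding_self f').
apply: cf'; exists (f \o e^-1%g); split.
  exact: gridding_comp Ex' Ey' (gridding_self f).
have := lex_before_comp Ex' lt; congr lex_before.
by apply/funext => i; rewrite /= permKV.
Qed.

Lemma canonical_ex n (pi : 'S_n) h :
  gridding c r (fun i : 'I_n => i : nat) (fun i => pi i : nat) h ->
  exists f : 'I_n -> A, canonical f /\ word_perm f = pi.
Proof.
move=> gh; pose kx (i : 'I_n) : nat := i; pose ky (i : 'I_n) : nat := pi i.
have kxI : injective kx by exact: val_inj.
have kyI : injective ky by move=> i j /val_inj/perm_inj.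
have [h0 [gh0 minh0]] := lex_minimal (P := gridding c r kx ky) kxI (ex_intro _ h gh).
have [e [Ex Ey nf]] := gridding_order kxI kyI gh0.
exists (h0 \o e); split; last by apply: (@word_perm_eq _ _ e) => i j; rewrite Ex Ey.
split=> // -[g [gg gl]]; apply: minh0; exists (g \o e^-1%g).
have Ex' i j : (xkey (h0 \o e) (e^-1%g i) < xkey (h0 \o e) (e^-1%g j)) = (kx i < kx j).
  by rewrite Ex !permKV.
split; first by apply: gridding_comp gg => // i j; rewrite Ey !permKV.
have := lex_before_comp Ex' gl; congr lex_before.
by apply/funext => i; rewrite /= permKV.
Qed.

End Words.

(** * Regularity of canonical words *)

(** The definition of [normal] is an automaton whose state is [F]. *)
Lemma recognizable_normal (A : finType) (c r : A -> nat) :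
  recognizable (fun n (f : 'I_n -> A) => normal c r finset.set0 (mkword f)).
Proof.
pose next (F : {set A}) a : {set A} :=
  [set b | ~~ dependent c r a b && ((b \in F) || (enum_rank b < enum_rank a))].
pose step (q : option {set A}) a :=
  if q is Some F then if a \in F then None else Some (next F a) else None.
have fold0 w : foldl step None w = None by elim: w.
apply: (@recognizable_fold _ _ (Some finset.set0) step isSome) => n f.
move: finset.set0 => F; suff -> : isSome (foldl step (Some F) (mkword f)) =
  normal c r F (mkword f) by [].
elim: (mkword f) F => //= a w IH F; case: (a \in F) => /=; first by rewrite fold0.
exact: IH.
Qed.

(** The order of two coordinates, decided by the lines and by whether the first
    point comes first. *)
Definition precedes (k l : nat) (b : bool) := (k < l) || ((k == l) && along k b (~~ b)).

Lemma ltn_ordC n (i j : 'I_n) : i != j -> (j < i) = ~~ (i < j).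
Proof. by case: (ltngtP i j) => // /val_inj->; rewrite eqxx. Qed.

Lemma ltn_coord_precedes n (lab : 'I_n -> nat) (i j : 'I_n) : i != j ->
  (coord n (lab i) i < coord n (lab j) j) = precedes (lab i) (lab j) (i < j).
Proof.
by move=> ij; rewrite ltn_coord // (ltn_ordC ij).
Qed.

Lemma recognizable_monotone (A B : finType) (k : A -> nat) (s : B -> nat) :
  recognizable (fun n (p : 'I_n -> A * B) => forall i j : 'I_n,
    coord n (k (p i).1) i < coord n (k (p j).1) j -> s (p i).2 <= s (p j).2).
Proof.
apply: recognizable_ext (recognizable_all2 (fun b (p q : A * B) =>
  precedes (k p.1) (k q.1) b ==> (s p.2 <= s q.2))) => n p.
split=> H i j.
  have [->//|ij] := eqVneq i j.
  by rewrite (ltn_coord_precedes (fun i => k (p i).1) ij); apply/implyP/H.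
by move=> ij; rewrite -(ltn_coord_precedes (fun i => k (p i).1) ij); apply/implyP/H.
Qed.

Section RecognizableCanonical.
Variables (A : finType) (c r : A -> nat).
Local Notation xkey := (xkey c).
Local Notation ykey := (ykey r).

(** [before] decided by letters alone: [p.1] is the letter of the given word,
    which determines the order of points, [p.2] the cell in the other gridding. *)
Definition before_letters (b : bool) (p q : A * A) :=
  ((c p.2 == c q.2) && along (c p.2) (precedes (c p.1) (c q.1) b)
                                     (precedes (c q.1) (c p.1) (~~ b))) ||
  ((r p.2 == r q.2) && along (r p.2) (precedes (r p.1) (r q.1) b)
                                     (precedes (r q.1) (r p.1) (~~ b))).

Lemma beforeE n (f h : 'I_n -> A) (i j : 'I_n) : i != j ->
  before c r (xkey f) (ykey f) h i j = before_letters (i < j) (f i, h i) (f j, h j).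
Proof.
move=> ij; have ji := ltn_ordC ij.
have key (k : A -> nat) : (coord n (k (f i)) i < coord n (k (f j)) j) =
    precedes (k (f i)) (k (f j)) (i < j) by exact: (ltn_coord_precedes (k \o f) ij).
have key' (k : A -> nat) : (coord n (k (f j)) j < coord n (k (f i)) i) =
    precedes (k (f j)) (k (f i)) (~~ (i < j)).
  by rewrite -ji; apply: (ltn_coord_precedes (k \o f)); rewrite eq_sym.
by rewrite /before /xkey /ykey !key !key'.
Qed.

(** The subsets and the sources in the definition of acyclicity are guessed as
    colourings; marking more than one source does no harm. *)
Lemma recognizable_acyclic :
  recognizable (fun n (p : 'I_n -> A * A) =>
    acyclic (before c r (xkey (fst \o p)) (ykey (fst \o p)) (snd \o p))).
Proof.
pose source n (p : 'I_n -> (A * A) * bool) := exists m : 'I_n -> bool,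
  (exists i, m i && (p i).2) /\ forall i j : 'I_n, i != j ->
    [&& m j, (p j).2 & (p i).2] ==> ~~ before_letters (i < j) (p i).1 (p j).1.
have rec_source : recognizable source.
  apply: recognizable_ex; apply: recognizable_and.
    exact: (@recognizable_has _ (fun q : (A * A * bool) * bool => q.2 && q.1.2)).
  exact: (@recognizable_all2 _ (fun b (q q' : (A * A * bool) * bool) =>
    [&& q'.2, q'.1.2 & q.1.2] ==> ~~ before_letters b q.1.1 q'.1.1)).
apply: (@recognizable_ext _ (fun n p => ~ exists Z : 'I_n -> bool,
    (exists i, Z i) /\ ~ source n (fun i => (p i, Z i)))); last first.
  apply/recognizable_not/recognizable_ex/recognizable_and.
    exact: (@recognizable_has _ (fun q : A * A * bool => q.2)).
  apply: recognizable_not; apply: recognizable_ext rec_source => n p.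
  suff -> : (fun i => ((fst \o p) i, (snd \o p) i)) = p by [].
  by apply/funext => i /=; case: (p i).
move=> n p; pose D := before c r (xkey (fst \o p)) (ykey (fst \o p)) (snd \o p).
have Dirr i : ~~ D i i by apply/negP => /orP[] /andP[_]; rewrite /along !ltnn; case: odd.
have DE i j : i != j -> D i j = before_letters (i < j) (p i) (p j).
  by move=> ij; rewrite /D beforeE // /comp -!surjective_pairing.
suff sourceP (Z : 'I_n -> bool) : source n (fun i => (p i, Z i)) <->
    exists z, Z z /\ forall z', Z z' -> ~~ D z' z.
  split=> [H Z Z0|H [Z [Z0]]]; last by apply; apply/sourceP/H.
  by apply: contrapT => nZ; apply: H; exists Z; split => // /sourceP.
split=> [[m [[z /andP[mz /= Zz]] H]]|[z [Zz H]]].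
  exists z; split => // z' Zz'; have [->//|zz'] := eqVneq z' z.
  by rewrite DE //; have := H _ _ zz'; rewrite /= mz Zz' Zz.
exists (pred1 z); split=> [|i j ij]; first by exists z; rewrite /= eqxx.
by rewrite -DE //; apply/implyP => /and3P[/eqP-> _]; apply: H.
Qed.

Lemma recognizable_lex_before :
  recognizable (fun n (p : 'I_n -> A * A) =>
    lex_before (xkey (fst \o p)) (snd \o p) (fst \o p)).
Proof.
apply: (@recognizable_ext _ (fun n (p : 'I_n -> A * A) => exists m : 'I_n -> bool,
  (exists i, m i && (enum_rank (p i).2 < enum_rank (p i).1)) /\
  forall i j : 'I_n, i != j ->
    m j && precedes (c (p i).1) (c (p j).1) (i < j) ==> ((p i).2 == (p i).1))).
  move=> n p; split=> [[m [[z /andP[mz lt]] H]]|[z [lt H]]].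
    exists z; split => // i; have [->|iz] := eqVneq i z; first by rewrite ltnn.
    rewrite /xkey (ltn_coord_precedes (fun i => c ((fst \o p) i)) iz) => iz'.
    by have := H _ _ iz; rewrite /= mz iz' => /eqP.
  exists (pred1 z); split=> [|i j ij]; first by exists z; rewrite /= eqxx.
  apply/implyP => /andP[/eqP jz]; subst j.
  by rewrite -(ltn_coord_precedes (fun i => c ((fst \o p) i)) ij) => /H/eqP.
apply: recognizable_ex; apply: recognizable_and.
  exact: (@recognizable_has _ (fun q : A * A * bool =>
    q.2 && (enum_rank q.1.2 < enum_rank q.1.1))).
exact: (@recognizable_all2 _ (fun b (q q' : A * A * bool) =>
  q'.2 && precedes (c q.1.1) (c q'.1.1) b ==> (q.1.2 == q.1.1))).
Qed.

(** A smaller gridding is guessed as a colouring of the positions by letters. *)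
Lemma recognizable_canonical : recognizable (canonical c r).
Proof.
apply: recognizable_and; first exact: recognizable_normal.
apply/recognizable_not/recognizable_ex/recognizable_and; last exact: recognizable_lex_before.
apply: (@recognizable_ext _ (fun n (p : 'I_n -> A * A) =>
  (forall i j : 'I_n, coord n (c (p i).1) i < coord n (c (p j).1) j ->
     c (p i).2 <= c (p j).2) /\
  (forall i j : 'I_n, coord n (r (p i).1) i < coord n (r (p j).1) j ->
     r (p i).2 <= r (p j).2) /\
  acyclic (before c r (xkey (fst \o p)) (ykey (fst \o p)) (snd \o p)))).
  by move=> n p; split=> [[? [? ?]]|[? ? ?]].
apply: recognizable_and; first exact: (recognizable_monotone c c).
apply: recognizable_and; first exact: (recognizable_monotone r r).
exact: recognizable_acyclic.
Qed.

(** Deleting letters moves no remaining point past another one. *)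
Lemma word_perm_subword m n (g : 'I_n -> A) (e : 'I_m -> 'I_n) :
  (forall i j : 'I_m, i < j -> e i < e j) ->
  contained (mkperm (word_perm c r (g \o e))) (mkperm (word_perm c r g)).
Proof.
move=> emono.
have eE (i j : 'I_m) : (e i < e j) = (i < j).
  case: (ltngtP i j) => [/emono//|/emono|/val_inj->]; last by rewrite ltnn.
  by case: ltngtP.
have [e1 H1] := word_permP c r (g \o e); have [e2 H2] := word_permP c r g.
have keyE (lab : A -> nat) (i j : 'I_m) :
    (coord n (lab (g (e i))) (e i) < coord n (lab (g (e j))) (e j)) =
    (coord m (lab (g (e i))) i < coord m (lab (g (e j))) j).
  by rewrite !ltn_coord // !eE.
exists (fun i : 'I_m => e2 (e ((e1^-1)%g i))); split=> /= i j.
  by rewrite (H2 _ _).1 /xkey keyE -[coord m _ _ < _](H1 _ _).1 !permKV.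
by rewrite (H2 _ _).2 /ykey keyE -[coord m _ _ < _](H1 _ _).2 !permKV.
Qed.

Lemma recognizable_class (C : set permutation) : permutation_class C ->
  recognizable (fun n (f : 'I_n -> A) => C (mkperm (word_perm c r f))).
Proof.
move=> Cclass; apply: recognizable_subword_closed => m n g e emono Cg.
by apply: Cclass Cg _; apply: word_perm_subword.
Qed.

End RecognizableCanonical.

(** * Simplicity and indecomposability *)

Lemma mkperm_inj n : injective (@mkperm n).
Proof. by move=> s t /eqP; rewrite eq_Tagged => /eqP. Qed.

(** Properties of permutations, read off the horizontal and the vertical order
    of their points, can be tested on the positions of a word instead. *)
Definition order_relation := forall n, ('I_n -> nat) -> ('I_n -> nat) -> Prop.

Definition order_invariant (P : order_relation) :=
  forall n (kx ky kx' ky' : 'I_n -> nat) (e : 'S_n),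
  (forall i j, (kx' (e i) < kx' (e j)) = (kx i < kx j)) ->
  (forall i j, (ky' (e i) < ky' (e j)) = (ky i < ky j)) ->
  P n kx' ky' -> P n kx ky.

Definition holds_on (P : order_relation) n (pi : 'S_n) :=
  P n (fun i => i : nat) (fun i => pi i : nat).

Lemma holds_on_word_perm (A : finType) (c r : A -> nat) (P : order_relation) :
  order_invariant P -> forall n (f : 'I_n -> A),
  P n (xkey c f) (ykey r f) <-> holds_on P (word_perm c r f).
Proof.
move=> Pinv n f; have [e H] := word_permP c r f.
split; last by apply: (Pinv _ _ _ _ _ e) => i j; rewrite ((H i j).1, (H i j).2).
apply: (Pinv _ _ _ _ _ (e^-1)%g) => i j.
  by rewrite -(H _ _).1 !permKV.
by rewrite -(H _ _).2 !permKV.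
Qed.

(** [splits true] is being a sum, [splits false] being a skew sum; [m] marks the
    first summand. *)
Definition splits (d : bool) : order_relation := fun n kx ky =>
  exists m : 'I_n -> bool, [/\ exists i, m i, exists j, ~~ m j
    & forall i j, m i -> ~~ m j ->
        kx i < kx j /\ (if d then ky i < ky j else ky j < ky i)].

Lemma splits_invariant d : order_invariant (splits d).
Proof.
move=> n kx ky kx' ky' e Ex Ey [m [[i mi] [j mj] H]].
exists (m \o e); split=> [||i' j' mi' mj'] /=.
- by exists ((e^-1)%g i); rewrite permKV.
- by exists ((e^-1)%g j); rewrite permKV.
by rewrite -Ex -!Ey; apply: H.
Qed.

Lemma splitsP (d : bool) n (pi : 'S_n) : holds_on (splits d) pi <->
  exists (k l : nat) (s1 : 'S_k) (s2 : 'S_l) (tau : 'S_(k + l)),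
    [/\ 0 < k, 0 < l, (if d then is_sum else is_skew_sum) k l s1 s2 tau
      & mkperm pi = mkperm tau].
Proof.
split=> [[m [[i0 mi0] [j0 mj0] H]]|[k [l [s1 [s2 [tau [k0 l0 + E]]]]]]]; last first.
  have nkl : n = k + l by have := congr1 plen E.
  move: E; subst n => /mkperm_inj-> dec.
  exists (fun i => i < k); split.
  - by exists (lshift l (Ordinal k0)).
  - by exists (rshift k (Ordinal l0)); rewrite /= addn0 ltnn.
  move=> i j; rewrite -[i]fintype.splitK -[j]fintype.splitK.
  case: (fintype.split i) => [i'|i'] /=; last by rewrite ltnNge leq_addr.
  case: (fintype.split j) => [j'|j'] /=; first by rewrite [j' < k]ltn_ord.
  move=> _ _; split; first by rewrite ltn_addr // ltn_ord.
  by case: d dec => -[_ _]; apply.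
(* The second summand starts at the first unmarked index. *)
case: (arg_minnP (P := fun j => ~~ m j) (fun j : 'I_n => j : nat) mj0) => k0 mk0 k0min.
have mE i : m i = (i < k0).
  apply/idP/idP => [mi|]; first exact: (H _ _ mi mk0).1.
  by apply: contraTT => /k0min; rewrite -leqNgt.
have kn := ltn_ord k0; move: (k0 : nat) mE kn => k mE kn {k0 mk0 k0min}.
have nkl : n = k + (n - k) by rewrite subnKC // ltnW.
have k0 : 0 < k by have := mE i0; rewrite mi0 => /esym; apply: leq_ltn_trans.
have l0 : 0 < n - k by rewrite subn_gt0.
move: (n - k) nkl l0 => l nkl l0; move: k mE k0 nkl {kn} => k mE k0 nkl; subst n.
have inj1 : injective (fun i : 'I_k => pi (lshift l i) : nat).
  by move=> i j /val_inj/perm_inj/lshift_inj.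
have inj2 : injective (fun i : 'I_l => pi (rshift k i) : nat).
  by move=> i j /val_inj/perm_inj/rshift_inj.
have [s1 s1E] := standardization inj1; have [s2 s2E] := standardization inj2.
exists k, l, s1, s2, pi; split => //.
have cross (i : 'I_k) (j : 'I_l) : if d then pi (lshift l i) < pi (rshift k j)
    else pi (rshift k j) < pi (lshift l i).
  by have [] := H (lshift l i) (rshift k j); rewrite ?mE /= ?ltn_ord // -leqNgt leq_addr.
by case: d H cross => H cross; split => // i j; rewrite ?s1E ?s2E.
Qed.

(** The two colourings tell for each point whether it lies left of, inside or
    right of an interval, and below, inside or above it. *)
Definition proper_interval : order_relation := fun n kx ky =>
  exists l : 'I_n -> 'I_3 * 'I_3,
  [/\ forall i j, kx i < kx j -> (l i).1 <= (l j).1,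
      forall i j, ky i < ky j -> (l i).2 <= (l j).2,
      forall i, ((l i).1 == 1 :> nat) = ((l i).2 == 1 :> nat),
      exists i j, [/\ i != j, (l i).1 = 1 :> nat & (l j).1 = 1 :> nat]
    & exists i, (l i).1 != 1 :> nat].

Lemma proper_interval_invariant : order_invariant proper_interval.
Proof.
move=> n kx ky kx' ky' e Ex Ey [l [lx ly lxy [i [j [ij li lj]]] [k lk]]].
exists (l \o e); split=> [i' j'|i' j'|i'||] /=.
- by rewrite -Ex => /lx.
- by rewrite -Ey => /ly.
- exact: lxy.
- exists ((e^-1)%g i), ((e^-1)%g j); rewrite !permKV; split => //.
  by rewrite (inj_eq perm_inj).
by exists ((e^-1)%g k); rewrite permKV.
Qed.

(** A contiguous set of values cuts the points into those below it, those in it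
    and those above it. *)
Lemma contiguousP n (k : 'S_n) (I : {set 'I_n}) : contiguous (k @: I) <->
  exists l : 'I_n -> 'I_3, (forall i j, k i < k j -> l i <= l j) /\
    forall i, (i \in I) = (l i == 1 :> nat).
Proof.
split=> [[a [b ab]]|[l [lmono lI]]].
  pose v i := if k i < a then 0 else if k i <= b then 1 else 2.
  have v3 i : v i < 3 by rewrite /v; case: ifP => // _; case: ifP.
  exists (fun i => Ordinal (v3 i)); split=> [i j|i]; rewrite /= /v; last first.
    rewrite -(mem_imset _ _ (@perm_inj _ k)) ab.
    by case: (ltnP (k i) a) => //= _; case: (leqP (k i) b).
  case: (ltnP (k i) a); case: (ltnP (k j) a); case: (leqP (k i) b);
    by case: (leqP (k j) b); lia.
have memI j : (j \in k @: I) = (l ((k^-1)%g j) == 1 :> nat).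
  by rewrite -{1}(permKV k j) mem_imset ?lI //; apply: perm_inj.
have [I0|[i0 i0I]] := set_0Vmem I.
  (* An empty set is contiguous with reversed bounds. *)
  by exists 1, 0 => i; rewrite I0 imset0 finset.in_set0; lia.
case: (arg_minnP (P := mem I) (fun i => k i : nat) i0I) => a aI amin.
case: (arg_maxnP (P := mem I) (fun i => k i : nat) i0I) => b bI bmax.
have la : l a = 1 :> nat by apply/eqP; rewrite -lI.
have lb : l b = 1 :> nat by apply/eqP; rewrite -lI.
exists (k a), (k b) => j; rewrite memI; apply/idP/idP => [|/andP[aj jb]].
  by rewrite -lI => jI; rewrite -(permKV k j) amin //; apply: bmax.
have leE i i' : k i <= k i' -> l i <= l i'.
  by rewrite leq_eqVlt => /orP[/eqP/val_inj/perm_inj->//|/lmono].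
have := @leE a ((k^-1)%g j); have := @leE ((k^-1)%g j) b.
by rewrite !permKV aj jb la lb => /(_ isT) u /(_ isT) v; rewrite eqn_leq u v.
Qed.

Lemma simple_permP n (pi : 'S_n) :
  simple_perm (mkperm pi) <-> 2 <= n /\ ~ holds_on proper_interval pi.
Proof.
have imset1 (I : {set 'I_n}) : (1%g : 'S_n) @: I = I.
  by apply/setP => i; rewrite -{1}[i](perm1 i) mem_imset //; apply: perm_inj.
split=> -[n2 H]; split => //=.
  move=> [l [lx ly lxy [i [j [ij li lj]]] [k lk]]].
  have /H : is_interval pi [set i | (l i).1 == 1 :> nat].
    split; first rewrite -[X in contiguous X]imset1; apply/contiguousP.
      by exists (fun i => (l i).1); split=> [i' j'|i']; rewrite ?perm1 ?inE //; apply: lx.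
    by exists (fun i => (l i).2); split=> [//|i']; rewrite inE.
  set I := [set _ | _] => cardI.
  have I2 : 1 < #|I|.
    by apply/card_gt1P; exists i, j; rewrite !inE li lj eqxx.
  have In : #|I| < n.
    rewrite -[ltnRHS]card_ord -cardsT; apply: proper_card; apply/properP.
    by split; [apply: finset.subsetT|exists k; rewrite !inE].
  by case: cardI => /= E; move: I2 In; rewrite E ?ltnn.
move=> I [/=]; rewrite -{1}[I]imset1.
move=> /contiguousP[lx [lx1 lx2]] /contiguousP[ly [ly1 ly2]].
have [I1|I1] := leqP #|I| 1.
  by case: #|I| I1 => [|[]] // _; [apply: Or31|apply: Or32].
have [In|In] := leqP n #|I|.
  by apply: Or33; apply/eqP; rewrite eqn_leq In andbT -[leqRHS]card_ord max_card.
exfalso; apply: H; exists (fun i => (lx i, ly i)); split=> /=.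
- by move=> i j ij; apply: lx1; rewrite !perm1.
- exact: ly1.
- by move=> i; rewrite -lx2 -ly2.
- have /card_gt1P[i [j [iI jI ij]]] := I1; exists i, j; split => //.
    by apply/eqP; rewrite -lx2.
  by apply/eqP; rewrite -lx2.
have /card_gt0P[i] : 0 < #|~: I| by rewrite cardsCs finset.setCK card_ord subn_gt0.
by rewrite inE lx2; exists i.
Qed.

Section RecognizableConditions.
Variables (A : finType) (c r : A -> nat).

Lemma recognizable_splits d :
  recognizable (fun n (f : 'I_n -> A) => splits d (xkey c f) (ykey r f)).
Proof.
pose Q b (p q : A * bool) := p.2 && ~~ q.2 ==> precedes (c p.1) (c q.1) b &&
  (if d then precedes (r p.1) (r q.1) b else precedes (r q.1) (r p.1) (~~ b)).
apply: recognizable_ex; apply: (@recognizable_ext _ (fun n (p : 'I_n -> A * bool) =>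
  (exists i, (p i).2) /\ (exists i, ~~ (p i).2) /\
  forall i j : 'I_n, i != j -> Q (i < j) (p i) (p j))); last first.
  apply: recognizable_and; first exact: recognizable_has.
  apply: recognizable_and; last exact: recognizable_all2.
  exact: (@recognizable_has _ (fun q : A * bool => ~~ q.2)).
move=> n p.
have QE (i j : 'I_n) : i != j -> Q (i < j) (p i) (p j) = ((p i).2 && ~~ (p j).2 ==>
    (xkey c (fst \o p) i < xkey c (fst \o p) j) &&
    (if d then ykey r (fst \o p) i < ykey r (fst \o p) j
     else ykey r (fst \o p) j < ykey r (fst \o p) i)).
  move=> ij; have ji : j != i by rewrite eq_sym.
  rewrite /Q -(ltn_ordC ij) /ykey /xkey.
  rewrite (ltn_coord_precedes (fun i => c ((fst \o p) i)) ij).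
  rewrite (ltn_coord_precedes (fun i => r ((fst \o p) i)) ij).
  by rewrite (ltn_coord_precedes (fun i => r ((fst \o p) i)) ji).
split=> [[H1 [H2 H]]|[H1 H2 H]].
  split=> // i j mi mj; have ij : i != j by apply: contraNneq mj => <-.
  have := H _ _ ij; rewrite QE // => /implyP; rewrite [(p i).2]mi mj => /(_ isT)/andP[].
  by case: d {Q H QE}.
split=> //; split=> // i j ij; rewrite QE //; apply/implyP => /andP[mi mj].
by have [-> ] := H i j mi mj.
Qed.

Lemma recognizable_proper_interval :
  recognizable (fun n (f : 'I_n -> A) => proper_interval (xkey c f) (ykey r f)).
Proof.
apply: recognizable_ex.
pose P1 n (p : 'I_n -> A * ('I_3 * 'I_3)) := forall i j : 'I_n,
  coord n (c (p i).1) i < coord n (c (p j).1) j -> (p i).2.1 <= (p j).2.1.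
pose P2 n (p : 'I_n -> A * ('I_3 * 'I_3)) := forall i j : 'I_n,
  coord n (r (p i).1) i < coord n (r (p j).1) j -> (p i).2.2 <= (p j).2.2.
pose P3 n (p : 'I_n -> A * ('I_3 * 'I_3)) :=
  ~ exists i, ((p i).2.1 == 1 :> nat) != ((p i).2.2 == 1 :> nat).
pose P4 n (p : 'I_n -> A * ('I_3 * 'I_3)) := ~ forall i j : 'I_n, i != j ->
  ~~ (((p i).2.1 == 1 :> nat) && ((p j).2.1 == 1 :> nat)).
pose P5 n (p : 'I_n -> A * ('I_3 * 'I_3)) := exists i, (p i).2.1 != 1 :> nat.
apply: (@recognizable_ext _ (fun n p =>
  P1 n p /\ P2 n p /\ P3 n p /\ P4 n p /\ P5 n p)).
  move=> n p; split=> [[H1 [H2 [H3 [H4 H5]]]]|[H1 H2 H3 [i [j [ij li lj]]] H5]].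
    split=> //= [i|].
      by apply: contrapT => neq; apply: H3; exists i; apply/eqP.
    apply: contrapT => H; apply: H4 => i j ij; apply/negP => /andP[/eqP li /eqP lj].
    by apply: H; exists i, j.
  split; [exact: H1|split; [exact: H2|split; [|split; [|exact: H5]]]].
    by move=> [k]; rewrite [X in X != _]H3 eqxx.
  by move=> /(_ i j ij)/negP; apply; apply/andP; split; apply/eqP.
apply: recognizable_and; first exact: (recognizable_monotone c (fun s : 'I_3 * 'I_3 => s.1)).
apply: recognizable_and; first exact: (recognizable_monotone r (fun s : 'I_3 * 'I_3 => s.2)).
apply: recognizable_and.
  apply: recognizable_not.
  exact: (@recognizable_has _ (fun q : A * ('I_3 * 'I_3) =>
    (q.2.1 == 1 :> nat) != (q.2.2 == 1 :> nat))).
apply: recognizable_and.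
  apply: recognizable_not.
  exact: (@recognizable_all2 _ (fun b (q q' : A * ('I_3 * 'I_3)) =>
    ~~ ((q.2.1 == 1 :> nat) && (q'.2.1 == 1 :> nat)))).
exact: (@recognizable_has _ (fun q : A * ('I_3 * 'I_3) => q.2.1 != 1 :> nat)).
Qed.

Lemma recognizable_indecomposable d : recognizable (fun n (f : 'I_n -> A) =>
  ~ holds_on (splits d) (word_perm c r f)).
Proof.
apply/recognizable_not/(recognizable_ext _ (recognizable_splits d)) => n f.
exact/holds_on_word_perm/splits_invariant.
Qed.

Lemma recognizable_simple : recognizable (fun n (f : 'I_n -> A) =>
  simple_perm (mkperm (word_perm c r f))).
Proof.
apply: (@recognizable_ext _ (fun n (f : 'I_n -> A) =>
  (~ forall i j : 'I_n, i != j -> false) /\ ~ proper_interval (xkey c f) (ykey r f))).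
  move=> n f; rewrite simple_permP (holds_on_word_perm c r proper_interval_invariant).
  suff -> : (~ forall i j : 'I_n, i != j -> false) <-> 2 <= n by [].
  split=> [H|n2].
    rewrite -[n]card_ord; apply/card_gt1P; apply: contrapT => n1; apply: H => i j ij.
    by case: n1; exists i, j.
  by move=> /(_ (Ordinal (ltnW n2)) (Ordinal n2) isT).
apply: recognizable_and; last exact/recognizable_not/recognizable_proper_interval.
exact/recognizable_not/(@recognizable_all2 _ (fun _ _ _ => false)).
Qed.

End RecognizableConditions.

(** * Points of the standard figure *)

Local Open Scope ring_scope.

(** Cutting each unit cell at its centre gives twice as many columns and rows.
    On either diagonal of the cell the horizontal and the vertical distance to
    the centre agree; this common distance is [d]. It grows to the right in
    right halves, which have odd numbers, and to the left in left halves, and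
    similarly for the rows. *)
Lemma standard_figure_half_cell (R : realType) t u (M : 'M[int]_(t, u)) (p : R * R) :
  standard_figure M p -> exists (a : 'I_t.*2 * 'I_u.*2) (d : R),
    [/\ 0 <= d, d <= 2^-1,
        p.1 = (if odd a.1 then a.1%:R / 2 + d else (a.1.+1)%:R / 2 - d)
      & p.2 = (if odd a.2 then a.2%:R / 2 + d else (a.2.+1)%:R / 2 - d)].
Proof.
move=> [k [l [/andP[kx xk] H]]].
have half n (i : 'I_n) (b : bool) : (b + i.*2 < n.*2)%N.
  by have := ltn_ord i; rewrite -leq_double doubleS; case: b => /=; lia.
have halfE (m : nat) (b : bool) (e : R) :
    (if odd (b + m.*2)%N then (b + m.*2)%N%:R / 2 + e
     else ((b + m.*2).+1)%:R / 2 - e) = m%:R + 2^-1 + (if b then e else - e).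
  rewrite oddD odd_double addbF oddb -(natr1 (b + m.*2)%N) natrD -muln2 natrM.
  by case: b => /=; lra.
have N1 : (-1 == 1 :> int) = false by [].
pose cell b b' : 'I_t.*2 * 'I_u.*2 := (Ordinal (half _ k b), Ordinal (half _ l b')).
have [right|left] := leP (k%:R + 2^-1) p.1.
  exists (cell true (M k l == 1)), (p.1 - (k%:R + 2^-1)); split; try lra.
    by apply: etrans (esym (halfE k true _)) => /=; lra.
  by apply: etrans (esym (halfE l _ _)); case: H => -[-> ->]; rewrite ?eqxx ?N1 /=; lra.
exists (cell false (M k l != 1)), (k%:R + 2^-1 - p.1); split; try lra.
  by apply: etrans (esym (halfE k false _)) => /=; lra.
by apply: etrans (esym (halfE l _ _)); case: H => -[-> ->]; rewrite ?eqxx ?N1 /=; lra.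
Qed.

(** Forced order means growing distance to the centre, so there are no cycles. *)
Lemma geom_gridding (R : realType) t u (M : 'M[int]_(t, u)) n (pi : 'S_n) :
  geom R M (mkperm pi) -> exists h : 'I_n -> 'I_t.*2 * 'I_u.*2,
    gridding (fun a : 'I_t.*2 * 'I_u.*2 => a.1 : nat) (fun a => a.2 : nat)
      (fun i : 'I_n => i : nat) (fun i => pi i : nat) h.
Proof.
move=> [p /= [pM px py]].
have /choice[h /choice[d hd]] := fun i => standard_figure_half_cell (pM i).
(* Half cells of different lines overlap at most in their boundary. *)
have mono (k l : nat) (x y e e' : R) :
    0 <= e -> e <= 2^-1 -> 0 <= e' -> e' <= 2^-1 ->
    x = (if odd k then k%:R / 2 + e else (k.+1)%:R / 2 - e) ->
    y = (if odd l then l%:R / 2 + e' else (l.+1)%:R / 2 - e') ->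
    x < y -> (k <= l)%N.
  move=> e0 e1 e0' e1' -> -> xy; rewrite leqNgt; apply/negP => lk.
  have : l%:R + 1 <= k%:R :> R by rewrite natr1 ler_nat.
  move: xy; rewrite -(natr1 k) -(natr1 l); case: (odd k); case: (odd l); lra.
(* On a common line the distance to the centre grows in its direction. *)
have closer (k : nat) (x y e e' : R) :
    x = (if odd k then k%:R / 2 + e else (k.+1)%:R / 2 - e) ->
    y = (if odd k then k%:R / 2 + e' else (k.+1)%:R / 2 - e') ->
    (if odd k then x < y else y < x) -> e < e'.
  by move=> -> ->; case: (odd k); lra.
exists h; split=> [i j ij|i j ij|Z [z0 Zz0]].
- have [i1 i2 i3 i4] := hd i; have [j1 j2 j3 j4] := hd j.
  exact: mono i1 i2 j1 j2 i3 j3 (px _ _ ij).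
- have [i1 i2 i3 i4] := hd i; have [j1 j2 j3 j4] := hd j.
  by apply: mono i1 i2 j1 j2 i4 j4 _; rewrite -py.
have [z Zz zmin] : exists2 z, Z z & forall z', Z z' -> d z <= d z'.
  by case: (Order.TotalTheory.arg_minP d Zz0) => z Zz zmin; exists z.
exists z; split => // z' /zmin; rewrite leNgt; apply: contra.
have [i1 i2 i3 i4] := hd z'; have [j1 j2 j3 j4] := hd z.
have pxE i j : ((p i).1 < (p j).1) = (i < j)%N.
  case: (ltngtP i j) => [/px//|/px/ltW|/val_inj->]; last by rewrite ltxx.
  by rewrite leNgt => /negbTE.
rewrite /before /along => /orP[]/andP[/eqP E].
  by rewrite -!pxE; apply: closer i3 _; rewrite E.
by rewrite !py; apply: closer i4 _; rewrite E.
Qed.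
Local Close Scope ring_scope.

(** * Enumeration by canonical words *)

(** Canonical words are in bijection with permutations that have a gridding, so
    a property of permutations that is recognizable on words is enumerated by
    the canonical words with that property. *)
Lemma canonical_words_enumerate (A : finType) (c r : A -> nat)
    (S : set permutation) :
  (forall n (pi : 'S_n), S (mkperm pi) -> exists h : 'I_n -> A,
     gridding c r (fun i : 'I_n => i : nat) (fun i => pi i : nat) h) ->
  recognizable (fun n (f : 'I_n -> A) => S (mkperm (word_perm c r f))) ->
  (exists (B : finType) (L : set (seq B)) (f : seq B -> permutation),
     [/\ regular_language L, forall w, L w -> plen (f w) = size w & set_bij L S f]) /\
  rational_series (fun n => (counting_sequence S n)%:R%R).
Proof.
move=> Sgrid Srec.
have [D DP] := recognizable_and (recognizable_canonical c r) Srec.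
pose word (w : seq A) := mkperm (word_perm c r (tnth (in_tuple w))).
have wordE n (t : n.-tuple A) : word t = mkperm (word_perm c r (tnth t)).
  case: t => w sz; have E := esym (eqP sz); subst n.
  congr (mkperm (word_perm c r _)); apply/funext => i.
  by have x0 := tnth (in_tuple w) i; rewrite [LHS](tnth_nth x0) [RHS](tnth_nth x0).
have DE n (t : n.-tuple A) : dfa_accepts D t <->
    canonical c r (tnth t) /\ S (mkperm (word_perm c r (tnth t))).
  by rewrite (DP n (tnth t)) mkword_tnth.
have onto n (pi : 'S_n) : S (mkperm pi) ->
    exists t : n.-tuple A, dfa_accepts D t /\ word_perm c r (tnth t) = pi.
  move=> Spi; have [h /canonical_ex [f [fcan fpi]]] := Sgrid _ _ Spi.
  exists (Tuple (introT eqP (size_mkword f))).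
  have E : tnth (Tuple (introT eqP (size_mkword f))) = f.
    by apply/funext; move=> k; rewrite (tnth_nth (f k)) nth_mkword.
  by rewrite DE E fpi.
have into n (t t' : n.-tuple A) : dfa_accepts D t -> dfa_accepts D t' ->
    word_perm c r (tnth t) = word_perm c r (tnth t') -> t = t'.
  move=> /DE[can _] /DE[can' _] /(canonical_inj can can') E.
  by apply: eq_from_tnth => k; rewrite E.
split.
  exists A, [set w | dfa_accepts D w]%classic, word; split=> //.
    by exists D.
  split=> [w|w w'|[n pi] /onto[t [tD tpi]]] /=.
  - by move=> /(DE _ (in_tuple w))[].
  - rewrite !inE => Dw Dw' ww'.
    have sw : size w' == size w by have /= -> := congr1 plen ww'.
    have same : word_perm c r (tnth (in_tuple w)) = word_perm c r (tnth (Tuple sw)).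
      by apply: mkperm_inj; rewrite -[RHS]wordE.
    by have /(congr1 val) := into _ (in_tuple w) (Tuple sw) Dw Dw' same.
  by exists t => //; rewrite wordE tpi.
have countE n : counting_sequence S n = #|[pred t : n.-tuple A | dfa_accepts D t]|.
  rewrite /counting_sequence.
  rewrite -(card_in_imset (f := fun t : n.-tuple A => word_perm c r (tnth t))).
    apply: eq_card => pi; rewrite [LHS]inE.
    apply/asboolP/imsetP => [/onto[t [tD tpi]]|[t tD ->]]; first by exists t.
    by have [] := (DE _ t).1 tD.
  by move=> t t' tD tD'; apply: into.
rewrite (_ : (fun n => _) = fun n => (#|[pred t : n.-tuple A | dfa_accepts D t]|%:R)%R).
  exact: rational_accepted.
by apply/funext => n; rewrite countE.
Qed.

Local Open Scope classical_set_scope.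
Local Open Scope ring_scope.

Theorem theorem9p1 (R : realType) (C : set permutation)
    (C_class : permutation_class C)
    (C_griddable : geometrically_griddable R C)
    (S : set permutation)
    (S_choice : [\/ S = [set pi | C pi /\ simple_perm pi],
                    S = [set pi | C pi /\ sum_indecomposable pi]
                  | S = [set pi | C pi /\ skew_indecomposable pi]]) :
  (exists (A : finType) (L : set (seq A)) (f : seq A -> permutation),
     [/\ regular_language L,
         forall w : seq A, L w -> plen (f w) = size w
       & set_bij L S f]) /\
  rational_series (fun n => (counting_sequence S n)%:R).
Proof.
have [t [u [M [_ CM]]]] := C_griddable.
pose c (a : 'I_t.*2 * 'I_u.*2) : nat := a.1.
pose r (a : 'I_t.*2 * 'I_u.*2) : nat := a.2.
have SC : S `<=` C by case: S_choice => -> pi [].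
have C_rec := recognizable_class c r C_class.
apply: (@canonical_words_enumerate _ c r).
  by move=> n pi /SC/CM; apply: geom_gridding.
case: S_choice => ->.
- exact: recognizable_and C_rec (recognizable_simple c r).
- apply: recognizable_ext (recognizable_and C_rec (recognizable_indecomposable c r true)).
  by move=> n f; rewrite splitsP.
- apply: recognizable_ext (recognizable_and C_rec (recognizable_indecomposable c r false)).
  by move=> n f; rewrite splitsP.
Qed.
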